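(* Let $T>0$, let $(X_\alpha)_{\alpha\in[0,2)}$, $A$ and $(S(t))_{t\ge 0}$ satisfy the structural assumptions listed in the context, let $x\in C^\eta([0,T])$ for some $\eta\in(1/2,1)$, let $\alpha\in(0,1)$ be such that $\alpha+\eta>1$, let $\sigma:X\to X$ satisfy the assumptions on $\sigma$ listed in the context with this $\alpha$, and let $\psi\in X_\alpha$. Let $F\in C^1([0,T]\times X)$ be a real-valued function such that $F_x$ is $\alpha$-Hölder continuous with respect to $t$, locally uniformly with respect to $x$, and is locally $\gamma$-Hölder continuous with respect to $x$, uniformly with respect to $t$, for some $\gamma\in(0,1)$ such that $\eta+\alpha\gamma>1$. Let $y$ be the unique mild solution to $$dy(t)=Ay(t)\,dt+\sigma(y(t))\,dx(t),\quad t\in(0,T],\qquad y(0)=\psi .$$ Then $$F(t,y(t))-F(s,y(s))=\int_s^tF_t(u,y(u))\,du+\int_s^t\langle F_x(u,y(u)),Ay(u)\rangle\,du+\int_s^t\langle F_x(u,y(u)),\sigma(y(u))\rangle\,dx(u)$$ for every $(s,t)\in[0,T]^2_<$.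
   Context: Notation. $F_t$ and $F_x$ denote the partial (Fréchet) derivatives of $F=F(t,x)$ with respect to $t\in[0,T]$ and $x\in X$; $F_x$ takes values in the dual $X'$ and $\langle\cdot,\cdot\rangle$ is the duality pairing between $X'$ and $X$. $[a,b]^2_<=\{(s,t)\in\mathbb R^2:a\le s<t\le b\}$. Structural assumptions. $X$ is a Banach space and $A:D(A)\subseteq X\to X$ is a linear operator which generates a semigroup $(S(t))_{t\ge0}$ of bounded linear operators on $X$, strongly continuous on $(0,\infty)$ (no strong continuity at $t=0$ is required; a typical example is the analytic semigroup generated by a sectorial operator). For every $\alpha\in[0,2)$ there is a (Banach) space $X_\alpha$, with norm $|\cdot|_\alpha$, with $X_0=X$ and $X_1=D(A)$, such that $X_\alpha$ is continuously embedded into $X_\beta$ if $\beta\le\alpha$. For every $T>0$: (a) for all $\zeta,\alpha\in[0,2)$ with $\zeta\le\alpha$ there is a constant $M_{\zeta,\alpha,T}>0$ with $\|S(t)\|_{\mathscr L(X_\zeta,X_\alpha)}\le M_{\zeta,\alpha,T}\,t^{-\alpha+\zeta}$ for $t\in(0,T]$; (b) for all $\mu,\nu\in[0,1]$ with $\mu>\nu$ there is a constant $C_{\mu,\nu,T}>0$ with $\|S(t)-I\|_{\mathscr L(X_\mu,X_\nu)}\le C_{\mu,\nu,T}\,t^{\mu-\nu}$ for $t\in(0,T]$. Function spaces. For $f\in C([a,b];X)$ put $(\hat\delta_1 f)(s,t)=f(t)-f(s)-(S(t-s)-I)f(s)=f(t)-S(t-s)f(s)$. For $\alpha,\beta\in[0,2)$,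 $C_\beta([a,b]^2_<;X_\alpha)$ is the space of $f\in C([a,b]^2_<;X_\alpha)$ with $\sup_{(s,t)\in[a,b]^2_<}|f(s,t)|_\alpha/|t-s|^\beta<\infty$, and $\hat C_\beta([a,b];X_\alpha)$ is the set of $f\in C([a,b];X_\alpha)$ with $\hat\delta_1f\in C_\beta([a,b]^2_<;X_\alpha)$. $C^\eta([a,b])$ is the space of real $\eta$-Hölder continuous functions. Young integrals. Let $x\in C^\eta([a,b])$, $(s,t)\in[a,b]^2_<$, and let $\Pi=\{s=t_0<\dots<t_n=t\}$ denote partitions of mesh $|\Pi|$. If $f$ is $\rho$-Hölder continuous on $[a,b]$ (with values in $\mathbb R$ or in $X$) with $\rho\in(1-\eta,1)$, then $\int_s^tf(u)\,dx(u):=\lim_{|\Pi|\to0}\sum_{i=0}^{n-1}f(t_i)(x(t_{i+1})-x(t_i))$. If $f\in\hat C_k([a,b];X_\beta)$ with $\beta\in[0,2)$ and $\eta+k>1$, then $\mathscr I_{Sf}(s,t)=\int_s^tS(t-r)f(r)\,dx(r):=\lim_{|\Pi|\to0}\sum_{i=0}^{n-1}S(t-t_i)f(t_i)(x(t_{i+1})-x(t_i))$. Both limits are known to exist; the integrals are $0$ if $s=t$. Assumptions on $\sigma$ (with parameter $\alpha$). $\sigma:X\to X$ is Fréchet differentiable with bounded and locally Lipschitz continuous Fréchet derivative; the restriction of $\sigma$ to $X_\alpha$ maps $X_\alpha$ into itself, is locally Lipschitz continuous on $X_\alpha$, and there is a constant $L_\sigma^\alpha>0$ with $|\sigma(z)|_\alpha\le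 L_\sigma^\alpha(1+|z|_\alpha)$ for $z\in X_\alpha$. Here ''locally Lipschitz'' means Lipschitz on every bounded set. Mild solution. A mild solution is a function $y:[0,T]\to X$ such that $\sigma(y)\in\hat C_\alpha([0,T];X)$ (with $\eta+\alpha>1$) and $y(t)=S(t)\psi+\mathscr I_{S\sigma(y)}(0,t)$ for every $t\in[0,T]$; ''the unique mild solution'' is the unique mild solution belonging to $\hat C_\alpha([0,T];X_\alpha)$. *)

(* Defs.v *)
From HB Require Import structures.
From mathcomp Require Import all_boot all_order all_algebra.
From mathcomp Require Import all_classical all_reals all_analysis.

Set Implicit Arguments.
Unset Strict Implicit.
Unset Printing Implicit Defensive.

Import Order.TTheory GRing.Theory Num.Theory.
Import numFieldNormedType.Exports.

Local Open Scope classical_set_scope.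
Local Open Scope ring_scope.

Section stieltjes.
Context {R : realType}.

(* A partition a = t_0 < ... < t_n = b is encoded, as in itv_partition, by the
   sequence [:: t_1; ...; t_n]. *)
Definition partition_point (a : R) (p : seq R) (i : nat) : R :=
  nth a (a :: p) i.

Definition fine_partitions (a b d : R) : set (seq R) :=
  [set p | itv_partition a b p /\ forall i, (i < size p)%N ->
             partition_point a p i.+1 - partition_point a p i < d].

(* Filter of the partitions of [a, b] whose mesh tends to 0. *)
Definition partitions (a b : R) : set_system (seq R) :=
  filter_from [set d : R | 0 < d] (fine_partitions a b).

Definition stieltjes_sum {V : lmodType R} (f : R -> V) (g : R -> R) (a : R)
    (p : seq R) : V :=
  \sum_(0 <= i < size p)
    (g (partition_point a p i.+1) - g (partition_point a p i))
      *: f (partition_point a p i).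

(* v is the limit of the left-point sums of f dg over [a, b]. For a = b the
   only partition is the empty sequence, so that v = 0. *)
Definition is_stieltjes_integral {V : normedModType R} (f : R -> V)
    (g : R -> R) (a b : R) (v : V) : Prop :=
  stieltjes_sum f g a @ partitions a b --> v.

Lemma fine_partitions_nonempty (a b d : R) :
  a <= b -> 0 < d -> fine_partitions a b d !=set0.
Proof.
move=> + d0; have [n] : exists n : nat, b - a <= n%:R * (d / 2).
  exists (Num.truncn ((b - a) / (d / 2))).+1.
  rewrite -ler_pdivrMr ?divr_gt0//; apply/ltW/truncnS_gt.
elim: n a => [|n ih] a; first rewrite mul0r subr_le0 => ba ab.
  exists [::]; split => //=; split => //=.
  by apply/eqP/le_anti; rewrite ab ba.
move=> H; rewrite le_eqVlt => /predU1P[->|ab].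
  by exists [::]; split => //; split => //=.
have d2 : d / 2 < d by rewrite ltr_pdivrMr// ltr_pMr// ltr1n.
have [bad|abd] := leP (b - a) (d / 2).
  exists [:: b]; split; first exact: itv_partition1.
  by case=> // _; rewrite /partition_point/=; apply: le_lt_trans d2.
have [||p [[pp lp] pd]] := ih (a + d / 2).
- by rewrite opprD addrA lerBlDr (le_trans H)// -natr1 mulrDl mul1r.
- by rewrite addrC -lerBrDr ltW.
exists (a + d / 2 :: p); split.
  by split => //=; rewrite pp andbT ltrDl divr_gt0.
case=> [_|i]; first by rewrite /partition_point/= addrAC subrr add0r.
rewrite /= ltnS => ip; have := pd i ip.
by rewrite /partition_point /=; case: i ip => [|i] ip /=;
  rewrite ?(set_nth_default (a + d / 2) a)//= ltnW.
Qed.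

Global Instance partitions_filter (a b : R) : Filter (partitions a b).
Proof.
apply: filter_from_filter; first by exists 1 => /=.
move=> d e d0 e0; exists (Num.min d e); first by rewrite /= lt_min d0.
move=> p [abp pde]; split; split => // i /pde; by rewrite lt_min => /andP[].
Qed.

Lemma partitions_proper (a b : R) : a <= b -> ProperFilter (partitions a b).
Proof.
move=> ab; apply: filter_from_proper => d d0.
exact: fine_partitions_nonempty.
Qed.

End stieltjes.

(* A Banach space continuously embedded into X is given by its underlying
   subspace of X and its own norm (irrelevant outside of the subspace); the
   continuity of the embeddings is part of interpolation_scale below. *)
Record banach_subspace (R : realType) (X : normedModType R) := BanachSubspace {
  bs_set :> X -> Prop ;
  bs_norm : X -> R ;
  bs_set0 : bs_set 0 ;
  bs_set_linear : forall (c : R) u v,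
    bs_set u -> bs_set v -> bs_set (c *: u + v) ;
  bs_norm_ge0 : forall u, bs_set u -> 0 <= bs_norm u ;
  bs_norm_eq0 : forall u, bs_set u -> bs_norm u = 0 -> u = 0 ;
  bs_normZ : forall (c : R) u, bs_set u -> bs_norm (c *: u) = `|c| * bs_norm u ;
  bs_normD : forall u v, bs_set u -> bs_set v ->
    bs_norm (u + v) <= bs_norm u + bs_norm v ;
  bs_complete : forall u_ : nat -> X, (forall n, bs_set (u_ n)) ->
    (forall e, 0 < e -> \forall m & n \near \oo, bs_norm (u_ m - u_ n) < e) ->
    exists2 l, bs_set l & bs_norm (u_ n - l) @[n --> \oo] --> (0 : R)
}.

Section semigroups.
Context {R : realType} {X : completeNormedModType R}.
Implicit Types (E G : banach_subspace X) (S : R -> X -> X) (D : set X)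
  (A : X -> X) (Xs : R -> banach_subspace X).

(* L maps E into G and its norm in L(E, G) is at most c. *)
Definition bounded_by E G (L : X -> X) (c : R) : Prop :=
  forall z, E z -> G (L z) /\ bs_norm G (L z) <= c * bs_norm E z.

Record linear_operator D A : Prop := LinearOperator {
  domain0 : D 0 ;
  domain_linear : forall (c : R) u v, D u -> D v -> D (c *: u + v) ;
  operator_linear : forall (c : R) u v, D u -> D v ->
    A (c *: u + v) = c *: A u + A v
}.

Record semigroup S : Prop := Semigroup {
  semigroup_linear : forall t, 0 <= t -> linear (S t) ;
  semigroup_bounded : forall t, 0 <= t -> continuous (S t) ;
  semigroup0 : forall z, S 0 z = z ;
  semigroupD : forall s t z, 0 <= s -> 0 <= t -> S (s + t) z = S s (S t z) ;
  semigroup_strongly_continuous : forall t z, 0 < t ->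
    {for t, continuous (fun r => S r z)}
}.

(* v is the integral of exp(-l r) S(r) z over [0, +oo). When S is strongly
   continuous on (0, +oo) and bounded near 0, the sums with left end-points
   compute the usual integral over [0, tau]. *)
Definition is_laplace_transform S (l : R) (z v : X) : Prop :=
  exists2 J : R -> X,
    (forall tau, 0 < tau ->
       is_stieltjes_integral (fun r => expR (- (l * r)) *: S r z) id 0 tau
         (J tau)) &
    J tau @[tau --> +oo] --> v.

(* The half-line l > w lies in the resolvent set of A, and (l - A)^-1 is the
   Laplace transform of S at l. This is the definition of the generator of a
   semigroup that is strongly continuous on (0, +oo) only (Arendt, Batty,
   Hieber, Neubrander, Vector-valued Laplace transforms and Cauchy problems,
   section 3.2). It covers the sectorial operators, even when D(A) is not
   dense; the operator defined by the derivative of S at 0 would then be a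
   proper restriction of A. For a C_0-semigroup the two notions agree. *)
Definition generates D A S : Prop :=
  linear_operator D A /\
  exists w : R, forall l, w < l ->
    (forall z, exists v, is_laplace_transform S l z v) /\
    (forall z v, is_laplace_transform S l z v <-> D v /\ l *: v - A v = z).

(* X_1 = D(A) is an equality of sets: the norm of X_1 is equivalent to the
   graph norm by the closed graph theorem. *)
Record interpolation_scale D Xs : Prop := InterpolationScale {
  scale0 : bs_set (Xs 0) = setT ;
  scale0_norm : forall z, bs_norm (Xs 0) z = `|z| ;
  scale1 : bs_set (Xs 1) = D ;
  scale_embedding : forall a b, 0 <= b -> b <= a -> a < 2 ->
    exists c, bounded_by (Xs a) (Xs b) id c
}.

Definition smoothing S Xs : Prop :=
  forall T, 0 < T -> forall zeta a, 0 <= zeta -> zeta <= a -> a < 2 ->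
    exists2 M, 0 < M & forall t, 0 < t -> t <= T ->
      bounded_by (Xs zeta) (Xs a) (S t) (M * t `^ (- a + zeta)).

Definition approx_identity S Xs : Prop :=
  forall T, 0 < T -> forall mu nu, 0 <= nu -> nu < mu -> mu <= 1 ->
    exists2 C, 0 < C & forall t, 0 < t -> t <= T ->
      bounded_by (Xs mu) (Xs nu) (fun z => S t z - z) (C * t `^ (mu - nu)).

Record structural_assumptions D A S Xs : Prop := StructuralAssumptions {
  structural_semigroup : semigroup S ;
  structural_generator : generates D A S ;
  structural_scale : interpolation_scale D Xs ;
  structural_smoothing : smoothing S Xs ;
  structural_approx : approx_identity S Xs
}.

(* f belongs to C(B; E). *)
Definition continuous_into {U : topologicalType} E (B : set U) (f : U -> X)
    : Prop :=
  (forall p, B p -> E (f p)) /\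
  (forall p, B p ->
     bs_norm E (f q - f p) @[q --> within B (nbhs p)] --> (0 : R)).

Definition triangle (a b : R) : set (R * R) :=
  [set st | [/\ a <= st.1, st.1 < st.2 & st.2 <= b]].

Definition hat_delta1 S (f : R -> X) (st : R * R) : X :=
  f st.2 - f st.1 - (S (st.2 - st.1) (f st.1) - f st.1).

(* C_beta([a, b]^2_<; E) *)
Definition C2 E (a b beta : R) (f : R * R -> X) : Prop :=
  continuous_into E (triangle a b) f /\
  exists K, forall st, triangle a b st ->
    bs_norm E (f st) <= K * (st.2 - st.1) `^ beta.

(* \hat C_beta([a, b]; E) *)
Definition hat_C S E (a b beta : R) (f : R -> X) : Prop :=
  continuous_into E `[a, b] f /\ C2 E a b beta (hat_delta1 S f).

(* v is the integral of S(t - r) f(r) dx(r) over [s, t]. *)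
Definition is_young_convolution S (f : R -> X) (x : R -> R) (s t : R) (v : X)
    : Prop :=
  is_stieltjes_integral (fun r => S (t - r) (f r)) x s t v.

Definition mild_solution S Xs (sigma : X -> X) (x : R -> R) (psi : X)
    (T alpha : R) (y : R -> X) : Prop :=
  hat_C S (Xs 0) 0 T alpha (sigma \o y) /\
  forall t, 0 <= t -> t <= T ->
    exists2 v, is_young_convolution S (sigma \o y) x 0 t v &
      y t = S t psi + v.

End semigroups.

Section regularity.
Context {R : realType} {X : completeNormedModType R}.

Definition holder_on (a b eta : R) (x : R -> R) : Prop :=
  exists K, forall s t, a <= s -> s <= b -> a <= t -> t <= b ->
    `|x t - x s| <= K * `|t - s| `^ eta.

(* The norm of the linear map L is at most c. *)
Definition opnorm_le {V W : normedModType R} (L : V -> W) (c : R) : Prop :=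
  forall v, `|L v| <= c * `|v|.

Record sigma_assumptions (Xs : R -> banach_subspace X) (alpha : R)
    (sigma : X -> X) : Prop := SigmaAssumptions {
  sigma_differentiable : forall z, differentiable sigma z ;
  sigma_diff_bounded : exists K, forall z, opnorm_le ('d sigma z) K ;
  sigma_diff_lipschitz : forall r, exists K, forall z w,
    `|z| <= r -> `|w| <= r ->
    opnorm_le (fun v => 'd sigma z v - 'd sigma w v) (K * `|z - w|) ;
  sigma_stable : forall z, Xs alpha z -> Xs alpha (sigma z) ;
  sigma_lipschitz : forall r, exists K, forall z w,
    Xs alpha z -> Xs alpha w ->
    bs_norm (Xs alpha) z <= r -> bs_norm (Xs alpha) w <= r ->
    bs_norm (Xs alpha) (sigma z - sigma w) <= K * bs_norm (Xs alpha) (z - w) ;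
  sigma_growth : exists2 L, 0 < L & forall z, Xs alpha z ->
    bs_norm (Xs alpha) (sigma z) <= L * (1 + bs_norm (Xs alpha) z)
}.

(* <F_x(t, z), v> *)
Definition diff_x (F : R -> X -> R) (t : R) (z v : X) : R :=
  'd (F t : X -> R^o) z v.

Definition strip (T : R) : set (R * X) := [set p | 0 <= p.1 <= T].

(* F belongs to C^1([0, T] x X), with partial derivatives Ft (one-sided at 0
   and at T) and diff_x F, both jointly continuous. *)
Record C1_with (T : R) (F Ft : R -> X -> R) : Prop := C1With {
  C1_dt : forall t z, 0 <= t -> t <= T ->
    (u - t)^-1 * (F u z - F t z) @[u --> within `[0, T] t^'] --> Ft t z ;
  C1_dt_continuous :
    {within strip T, continuous (fun p : R * X => Ft p.1 p.2)} ;
  C1_dx : forall t z, 0 <= t -> t <= T ->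
    differentiable (F t : X -> R^o) z ;
  C1_dx_continuous : forall p, strip T p -> forall e, 0 < e ->
    \forall q \near within (strip T) (nbhs p),
      opnorm_le (fun v => diff_x F q.1 q.2 v - diff_x F p.1 p.2 v : R^o) e
}.

(* As for locally Lipschitz, "locally" means on every bounded subset of X. *)
Definition diff_x_holder_t (T alpha : R) (F : R -> X -> R) : Prop :=
  forall r, exists K, forall z s t, `|z| <= r ->
    0 <= s -> s <= T -> 0 <= t -> t <= T ->
    opnorm_le (fun v => diff_x F t z v - diff_x F s z v : R^o) (K * `|t - s| `^ alpha).

Definition diff_x_holder_x (T gamma : R) (F : R -> X -> R) : Prop :=
  forall r, exists K, forall t z w, 0 <= t -> t <= T ->
    `|z| <= r -> `|w| <= r ->
    opnorm_le (fun v => diff_x F t z v - diff_x F t w v : R^o) (K * `|z - w| `^ gamma).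

End regularity.

(* Main.v *)
From HB Require Import structures.
Require Import Defs.
From mathcomp Require Import all_boot all_order all_algebra.
From mathcomp Require Import all_classical all_reals all_analysis.
From mathcomp Require Import measurable_realfun.
From mathcomp Require Import ring lra.
Import Order.TTheory GRing.Theory Num.Theory.
Import numFieldNormedType.Exports.
Set Implicit Arguments.
Unset Strict Implicit.
Unset Printing Implicit Defensive.
Local Open Scope classical_set_scope.
Local Open Scope ring_scope.

(** Along a partition of [[s, t]], the increment of [F (r, y r)] over a step
    [[u, v]] of length [h] is compared with the increments of the two Lebesgue
    integrals and with the Young term [<F_x (u, y u), sigma (y u)> (x v - x u)].
    If the error is at most [o(1)] times the increment of [W r = r + r ^ alpha],
    then, everything else telescoping, the sums of the Young terms converge to
    what the formula claims; the existence of the Young integral is a by-product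
    ([stieltjes_integral_telescope]).

    Write [I (u, v) = y v - S (v - u) (y u)] for the Young convolution over
    [[u, v]]. Bisection gives
    [I (u, v) = (x v - x u) sigma (y u) + O(h ^ (alpha + eta))] in [X]
    ([young_estimate], [increment_estimate0]). Moreover [I (u, v)] lies in
    [D(A)] and [A I (u, v) = O(h ^ (alpha + eta - 1))]: cut [[u, v]] at the
    points [v - h / 2 ^ n]; each piece is transported to [v] by [S] over a time
    equal to its length, which smoothes it, the resulting series is geometric
    because [alpha + eta > 1], and [A] is closed ([generator_increment]). Hence
    [y r] is in [D(A)] for [r > 0], and [A (y r) = O(r ^ (alpha - 1))] is
    continuous on [(0, T]], which makes the integrands integrable.

    The increment of [F] is split into the time increment, whose error is an
    oscillation of [F_t], and the space increment [L (y v - y u)], where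
    [L = F_x (u, xi)] is given by the mean value theorem. As [y] is
    [alpha]-Hoelder continuous, [L] differs from [F_x (r, y r)] by
    [O(h ^ (alpha gamma))] for all [r] in [[u, v]]. Now
    [y v - y u = (S h (y u) - y u) + I (u, v)]. Applied to the first term, [L]
    is differentiated in [h]: since [A S (r - u) (y u) = A (y r) - A I (u, r)],
    it follows the integral of [<F_x (r, y r), A (y r)>] up to
    [O(h ^ (alpha gamma) (v ^ alpha - u ^ alpha) + h ^ (alpha + eta))]
    ([orbit_increment]). The second term gives the Young term up to
    [O(h ^ (alpha + eta) + h ^ (eta + alpha gamma))] ([convolution_increment]).
    The increments of [r ^ alpha] in the control make these bounds uniform down
    to [u = 0], in spite of the singularity of [A (y r)] there.

    On the semigroup side, the generator is only known through the Laplace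
    transform of the orbits. Truncating the transform at [h] expresses
    [z - exp (- l h) S h z], for [z] in [D(A)], as an integral over [[0, h]]
    ([laplace_transform_truncated]); this yields the differentiability of the
    orbits ([orbit_derive]) and the closedness of [A] ([generator_closed]). *)

(** * Stieltjes integrals along partitions *)

Section stieltjes_integral.
Context {R : realType}.
Implicit Types (V : normedModType R) (g : R -> R) (a b c d : R) (p : seq R).

Lemma stieltjes_integralP V (f : R -> V) g a b (v : V) :
  is_stieltjes_integral f g a b v <->
  forall e, 0 < e -> exists2 d, 0 < d &
    forall p, fine_partitions a b d p -> `|stieltjes_sum f g a p - v| < e.
Proof.
split=> [fv e e0|H].
  have /cvgrPdist_lt/(_ e e0)[d /= d0 dP] := fv.
  by exists d => // p /dP; rewrite /= distrC.
apply/cvgrPdist_lt => e e0; have [d d0 dP] := H e e0.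
by exists d => // p /dP; rewrite /= distrC.
Qed.

Lemma partition_point_cons a t p i : (i <= size p)%N ->
  partition_point a (t :: p) i.+1 = partition_point t p i.
Proof.
by move=> ip; rewrite /partition_point/= (set_nth_default t).
Qed.

Lemma stieltjes_sum_nil V (f : R -> V) g a : stieltjes_sum f g a [::] = 0.
Proof. by rewrite /stieltjes_sum big_nil. Qed.

Lemma stieltjes_sum_cons V (f : R -> V) g a t p :
  stieltjes_sum f g a (t :: p) = (g t - g a) *: f a + stieltjes_sum f g t p.
Proof.
rewrite /stieltjes_sum /= big_nat_recl//; congr +%R.
by apply: eq_big_nat => i /andP[_ ip]; rewrite !partition_point_cons// ltnW.
Qed.

Lemma fine_partitions_nil a b d : fine_partitions a b d [::] <-> a = b.
Proof.
by split=> [[/itv_partition_nil]//|->]; split => //; split => //=.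
Qed.

Lemma fine_partitions_cons a b d t p :
  fine_partitions a b d (t :: p) <->
  [/\ a < t, t - a < d & fine_partitions t b d p].
Proof.
split=> [[[/= /andP[at_ pt] tb] H]|[at_ tad [[pt tb] H]]].
  split=> //; first exact: (H 0%N).
  split=> // i ip; have := H i.+1 ip.
  by rewrite !partition_point_cons// ltnW.
split; first by split => //=; rewrite at_.
move=> [_|i]//=; rewrite ltnS => ip.
by rewrite !partition_point_cons//; [exact: H|exact: ltnW].
Qed.

Lemma fine_partitions_cat a b c d p q : fine_partitions a b d p ->
  fine_partitions b c d q -> fine_partitions a c d (p ++ q).
Proof.
elim: p a => [a /fine_partitions_nil ->//|t p ih a].
move=> /fine_partitions_cons[at_ tad tp] bq; apply/fine_partitions_cons.
by split => //; exact: ih.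
Qed.

Lemma stieltjes_sum_cat V (f : R -> V) g a b d p q :
  fine_partitions a b d p ->
  stieltjes_sum f g a (p ++ q) = stieltjes_sum f g a p + stieltjes_sum f g b q.
Proof.
elim: p a => [a /fine_partitions_nil ->|t p ih a /=].
  by rewrite stieltjes_sum_nil add0r.
move=> /fine_partitions_cons[_ _ tp].
by rewrite !stieltjes_sum_cons ih// addrA.
Qed.

Lemma fine_partitions_le a b d p : fine_partitions a b d p -> a <= b.
Proof. by move=> [/itv_partition_le]. Qed.

Lemma fine_partitionsW a b d d' p : d <= d' -> fine_partitions a b d p ->
  fine_partitions a b d' p.
Proof.
by move=> dd' [abp H]; split => // i ip; exact: lt_le_trans (H i ip) dd'.
Qed.

(** The part over [[a, b]] of a partition of [[a, c]] through [b] can be held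
    fixed at a good approximation of its own integral. *)
Lemma stieltjes_integralB V (f : R -> V) g a b c (v w : V) : a <= b ->
  is_stieltjes_integral f g a b v -> is_stieltjes_integral f g a c w ->
  is_stieltjes_integral f g b c (w - v).
Proof.
move=> ab /stieltjes_integralP fv /stieltjes_integralP fw.
apply/stieltjes_integralP => e e0.
have e2 : 0 < e / 2 by rewrite divr_gt0.
have [d1 d10 dv] := fv _ e2; have [d2 d20 dw] := fw _ e2.
have d0 : 0 < Num.min d1 d2 by rewrite lt_min d10.
exists (Num.min d1 d2) => // q bcq.
have [p abp] := fine_partitions_nonempty ab d0.
have acp := fine_partitions_cat abp bcq.
have := dw _ (fine_partitionsW _ acp); rewrite ge_min lexx orbT => /(_ isT).
have := dv _ (fine_partitionsW _ abp); rewrite ge_min lexx => /(_ isT).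
rewrite (stieltjes_sum_cat _ _ _ abp) => H1 H2.
rewrite [ltRHS](splitr e) (_ : _ - _ =
  (stieltjes_sum f g a p + stieltjes_sum f g b q - w)
  - (stieltjes_sum f g a p - v)); last first.
  by rewrite !opprD !opprK; rewrite (addrC (stieltjes_sum f g a p)) -!addrA;
    congr +%R; rewrite addrCA (addrA _ (- _)) subrr add0r addrC.
by apply: le_lt_trans (ler_normB _ _) _; rewrite ltrD.
Qed.

Lemma stieltjes_integral_unique V (f : R -> V) g a b (v w : V) : a <= b ->
  is_stieltjes_integral f g a b v -> is_stieltjes_integral f g a b w -> v = w.
Proof.
move=> ab; have := partitions_proper ab => ?.
by apply: cvg_unique; exact: norm_hausdorff.
Qed.

Lemma stieltjes_sum_linear V (f : R -> V) g a p (L : {linear V -> V}) :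
  stieltjes_sum (L \o f) g a p = L (stieltjes_sum f g a p).
Proof.
by rewrite /stieltjes_sum linear_sum; apply: eq_bigr => i _; rewrite linearZ.
Qed.

Lemma stieltjes_integral_linear V (f : R -> V) g a b (v : V) (L : V -> V) :
  linear L -> continuous L -> is_stieltjes_integral f g a b v ->
  is_stieltjes_integral (L \o f) g a b (L v).
Proof.
move=> Ll Lc fv.
pose L' : {linear V -> V} := HB.pack L (GRing.isLinear.Build _ _ _ _ L Ll).
rewrite /is_stieltjes_integral.
have -> : stieltjes_sum (L \o f) g a = L \o stieltjes_sum f g a.
  by apply/funext => p; exact: (stieltjes_sum_linear f g a p L').
by apply: cvg_comp fv _; exact: Lc.
Qed.

Lemma eq_stieltjes_sum V (f f' : R -> V) g a b d p :
  (forall r, a <= r -> r < b -> f r = f' r) ->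
  fine_partitions a b d p -> stieltjes_sum f g a p = stieltjes_sum f' g a p.
Proof.
elim: p a => [|t p ih] a ff'; first by rewrite !stieltjes_sum_nil.
move=> /fine_partitions_cons[at_ tad tp].
have tb := fine_partitions_le tp.
rewrite !stieltjes_sum_cons ff'// ?ih// => [r tr rb|]; last first.
  exact: lt_le_trans tb.
by rewrite ff'// (le_trans (ltW at_)).
Qed.

Lemma eq_stieltjes_integral V (f f' : R -> V) g a b (v : V) :
  (forall r, a <= r -> r < b -> f r = f' r) ->
  is_stieltjes_integral f g a b v -> is_stieltjes_integral f' g a b v.
Proof.
move=> ff' /stieltjes_integralP fv; apply/stieltjes_integralP => e /fv[d d0 H].
by exists d => // p abp; rewrite -(eq_stieltjes_sum g ff' abp); exact: H.
Qed.

Lemma riemann_integral_shift V (f : R -> V) h a b (v : V) :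
  is_stieltjes_integral f id a b v ->
  is_stieltjes_integral (fun r => f (r - h)) id (a + h) (b + h) v.
Proof.
move=> /stieltjes_integralP fv; apply/stieltjes_integralP => e /fv[d d0 H].
exists d => // p abp; have {}H := H [seq r - h | r <- p].
have -> : stieltjes_sum (fun r => f (r - h)) id (a + h) p =
    stieltjes_sum f id a [seq r - h | r <- p].
  elim: p a {fv abp H} => [|t p ih] a; first by rewrite !stieltjes_sum_nil.
  have := ih (t - h); rewrite subrK /= !stieltjes_sum_cons addrK => ->.
  by rewrite opprD addrA addrAC.
apply: H; elim: p a {fv} abp => [a|t p ih a].
  by move=> /fine_partitions_nil/addIr ->; apply/fine_partitions_nil.
move=> /fine_partitions_cons[at_ tad tp]; apply/fine_partitions_cons; split.
- by rewrite ltrBrDr.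
- by rewrite addrAC -addrA -opprD.
- by apply: ih; rewrite subrK.
Qed.

(** Along a partition, both the increments of [Phi] and those of the control [W]
    telescope. The existence of the integral thus comes together with its
    value: this is how the Young integral of the chain rule is obtained. *)
Lemma stieltjes_integral_telescope V (f : R -> V) g (Phi : R -> V) (W : R -> R)
    a b : a <= b -> W a <= W b ->
  (forall e, 0 < e -> exists2 d, 0 < d & forall u v,
     a <= u -> u < v -> v <= b -> v - u < d ->
     `|(g v - g u) *: f u - (Phi v - Phi u)| <= e * (W v - W u)) ->
  is_stieltjes_integral f g a b (Phi b - Phi a).
Proof.
move=> ab Wab H; apply/stieltjes_integralP => e e0.
have c0 : 0 < W b - W a + 1 by rewrite ltr_wpDl// subr_ge0.
have [d d0 dP] := H (e / (W b - W a + 1)) (divr_gt0 e0 c0).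
exists d => // p abp.
suff : `|stieltjes_sum f g a p - (Phi b - Phi a)|
    <= e / (W b - W a + 1) * (W b - W a).
  move=> /le_lt_trans; apply.
  by rewrite -mulrA gtr_pMr// mulrC ltr_pdivrMr// mul1r ltrDl.
move: (e / _) dP => {Wab c0 e0 H}{}e.
elim: p a ab abp => [|t p ih] a ab.
  move=> /fine_partitions_nil <- _.
  by rewrite stieltjes_sum_nil !subrr normr0 mulr0.
move=> /fine_partitions_cons[at_ tad tp] H; have tb := fine_partitions_le tp.
rewrite stieltjes_sum_cons.
have -> : Phi b - Phi a = Phi t - Phi a + (Phi b - Phi t).
  by rewrite [RHS]addrC addrA subrK.
have -> : W b - W a = W t - W a + (W b - W t) by ring.
rewrite opprD addrACA (le_trans (ler_normD _ _))// mulrDr lerD//.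
  exact: H.
apply: ih => // u v tu; apply: H; exact: le_trans (ltW at_) tu.
Qed.

Lemma riemann_integral_approx V (f : R -> V) (v z : V) a b e : a <= b ->
  (forall r, a <= r -> r <= b -> `|f r - z| <= e) ->
  is_stieltjes_integral f id a b v -> `|v - (b - a) *: z| <= e * (b - a).
Proof.
move=> ab H /stieltjes_integralP fv; apply/ler_addgt0Pl => k k0.
have [d d0 dP] := fv _ k0; have [p abp] := fine_partitions_nonempty ab d0.
rewrite -(subrKA (stieltjes_sum f id a p)) (le_trans (ler_normD _ _))// lerD//.
  by rewrite distrC ltW// dP.
elim: p a {ab dP fv} H abp => [|t p ih] a H.
  by move=> /fine_partitions_nil ->; rewrite stieltjes_sum_nil !subrr scale0r
    subrr normr0 mulr0.
move=> /fine_partitions_cons[at_ tad tp]; have tb := fine_partitions_le tp.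
rewrite stieltjes_sum_cons.
have -> : b - a = t - a + (b - t) by ring.
rewrite (scalerDl z) opprD addrACA mulrDr (le_trans (ler_normD _ _))// lerD//.
  rewrite -scalerBr normrZ ger0_norm ?subr_ge0 ?(ltW at_)// mulrC.
  by rewrite ler_wpM2r ?subr_ge0 ?(ltW at_)// H// (le_trans (ltW at_)).
by apply: ih => // r tr rb; apply: H => //; exact: le_trans (ltW at_) tr.
Qed.

End stieltjes_integral.

(** * Young's estimate *)

Section young.
Context {R : realType}.

Lemma half_powR_lt1 (e : R) : 0 < e -> 2^-1 `^ e < 1.
Proof.
move=> e0; have := @gt0_ltr_powR R e e0 2^-1 1.
rewrite powR1; apply; rewrite ?nnegrE ?invr_ge0//.
by rewrite invf_lt1// ltr1n.
Qed.

Lemma powR_half (h e : R) : 0 <= h -> (h / 2) `^ e = 2^-1 `^ e * h `^ e.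
Proof. by move=> h0; rewrite powRM ?invr_ge0// mulrC. Qed.

(** The contraction factor of the sewing argument: a germ of order
    [theta > 1], summed over the two halves of an interval, gains it. *)
Definition sewing_ratio (theta : R) : R := 2 * 2^-1 `^ theta.

Lemma sewing_ratio_lt1 theta : 1 < theta -> sewing_ratio theta < 1.
Proof.
move=> th; rewrite /sewing_ratio -{1}(subrK 1 theta) powRD; last first.
  by rewrite invr_neq0// implybT.
rewrite powRr1 ?invr_ge0// mulrCA divff// mulr1.
by rewrite half_powR_lt1// subr_gt0.
Qed.

Section sewing.
Variables (V : normedModType R) (f : R -> V) (g : R -> R) (a b C theta : R).
Hypothesis theta1 : 1 < theta.
Hypothesis defect : forall u v, a <= u -> u < v -> v <= b ->
  `|(g v - g ((u + v) / 2)) *: (f ((u + v) / 2) - f u)| <= C * (v - u) `^ theta.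

Let K := C / (1 - sewing_ratio theta).

Lemma dyadic_partition n u v d : a <= u -> u < v -> v <= b ->
  (v - u) / 2 ^+ n < d ->
  exists2 p, fine_partitions u v d p &
    `|stieltjes_sum f g u p - (g v - g u) *: f u| <= K * (v - u) `^ theta.
Proof.
have r1 : 0 < 1 - sewing_ratio theta by rewrite subr_gt0 sewing_ratio_lt1.
elim: n u v => [|n ih] u v au uv vb uvd.
  rewrite expr0 divr1 in uvd; exists [:: v].
    by apply/fine_partitions_cons; split => //; apply/fine_partitions_nil.
  rewrite stieltjes_sum_cons stieltjes_sum_nil addr0 subrr normr0.
  rewrite mulr_ge0 ?powR_ge0// divr_ge0 ?(ltW r1)//.
  have := le_trans (normr_ge0 _) (defect au uv vb).
  by rewrite pmulr_lge0// powR_gt0// subr_gt0.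
set m := (u + v) / 2.
have um : u < m by rewrite /m; lra.
have mv : m < v by rewrite /m; lra.
have mu : m - u = (v - u) / 2 by rewrite /m; lra.
have vm : v - m = (v - u) / 2 by rewrite /m; lra.
have h2 : (v - u) / 2 / 2 ^+ n < d by rewrite -mulrA -invfM -exprS.
have mb : m <= b := le_trans (ltW mv) vb.
have am : a <= m := le_trans au (ltW um).
have [|p ump pP] := ih u m au um mb; first by rewrite mu.
have [|q mvq qP] := ih m v am mv vb; first by rewrite vm.
exists (p ++ q); first exact: fine_partitions_cat ump mvq.
rewrite (stieltjes_sum_cat _ _ _ ump).
have -> : stieltjes_sum f g u p + stieltjes_sum f g m q - (g v - g u) *: f u
  = stieltjes_sum f g u p - (g m - g u) *: f u
    + (stieltjes_sum f g m q - (g v - g m) *: f m)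
    + (g v - g m) *: (f m - f u).
  have -> : (g v - g u) *: f u = (g m - g u) *: f u + (g v - g m) *: f u.
    by rewrite -scalerDl; congr (_ *: _); ring.
  by rewrite scalerBr -[RHS]addrA subrKA opprD addrACA.
rewrite (le_trans (ler_normD _ _))//.
have -> : K = sewing_ratio theta * K + C by rewrite /K; field; rewrite gt_eqF.
rewrite [leRHS]mulrDl lerD//; last exact: defect.
rewrite (le_trans (ler_normD _ _))//.
move: pP qP; rewrite mu vm powR_half ?subr_ge0 ?(ltW uv)// => pP qP.
apply: le_trans (lerD pP qP) _.
by rewrite le_eqVlt /sewing_ratio; apply/orP; left; apply/eqP; ring.
Qed.

(** Young's estimate, obtained by bisection: passing from the one-point sum to
    the sums over the dyadic partitions costs at each step a defect whose total
    shrinks geometrically. *)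
Lemma young_estimate (w : V) : a < b -> is_stieltjes_integral f g a b w ->
  `|w - (g b - g a) *: f a| <= K * (b - a) `^ theta.
Proof.
move=> ab /stieltjes_integralP fw; apply/ler_addgt0Pl => e e0.
have [d d0 dP] := fw _ e0.
have [n nd] : exists n, (b - a) / 2 ^+ n < d.
  have de : 0 < d / (b - a) by rewrite divr_gt0// subr_gt0.
  have [n _ /(_ n (leqnn n))/= nd] := near_infty_natSinv_expn_lt (PosNum de).
  exists n; move: nd; rewrite div1r ltr_pdivlMr ?subr_gt0// mulrC.
  by [].
have [p abp pP] := dyadic_partition (lexx a) ab (lexx b) nd.
rewrite -(subrKA (stieltjes_sum f g a p)) (le_trans (ler_normD _ _))// lerD//.
by rewrite distrC ltW// dP.
Qed.

End sewing.
End young.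

(** * Derivatives of curves *)

Section curve_derivative.
Context {R : realType} {V : normedModType R}.
Implicit Types (f : R -> V) (h : R) (v : V).

Lemma is_derive_quotientP f h v : is_derive h 1 f v <->
  k^-1 *: (f (k + h) - f h) @[k --> 0^'] --> v.
Proof.
have E : (fun k : R => k^-1 *: ((f \o shift h) (k *: 1) - f h)) =
         (fun k : R => k^-1 *: (f (k + h) - f h)).
  by apply/funext => k /=; rewrite /shift /= [k *: 1]mulr1.
split=> [[]|fv].
  by rewrite /derivable /derive E => /cvg_ex[l fl] <-; rewrite (cvg_lim _ fl).
split; first by rewrite /derivable E; apply/cvg_ex; exists v.
by rewrite /derive E; exact: cvg_lim.
Qed.

Lemma is_derive_increment f h v :
  (forall e, 0 < e -> exists2 d, 0 < d & forall k, k != 0 -> `|k| < d ->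
     `|f (k + h) - f h - k *: v| <= e * `|k|) -> is_derive h 1 f v.
Proof.
move=> H; apply/is_derive_quotientP/cvgrPdist_le => e /H[d d0 dP].
near=> k; have k0 : k != 0 by near: k; exact: nbhs_dnbhs_neq.
have -> : v = k^-1 *: (k *: v) by rewrite scalerA mulVf// scale1r.
rewrite -scalerBr normrZ normfV mulrC ler_pdivrMr ?normr_gt0// distrC.
apply: dP => //; near: k; apply: dnbhs0_lt; exact: d0.
Unshelve. all: by end_near. Qed.

End curve_derivative.

Section curve_derivative_operations.
Context {R : realType} {V : normedModType R}.
Implicit Types (f : R -> V) (h : R) (v : V).

Lemma is_derive_scale (c : R -> R) f h dc v : is_derive h 1 c dc ->
  is_derive h 1 f v ->
  is_derive h 1 (fun r => c r *: f r) (c h *: v + dc *: f h).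
Proof.
move=> cdc fv.
have chc : c (k + h) @[k --> 0^'] --> c h.
  have /derivable1_diffP/differentiable_continuous : derivable c h 1.
    by case: cdc.
  by move=> /continuous_withinNshiftx.
move/is_derive_quotientP : cdc => cdc; move/is_derive_quotientP : fv => fv.
apply/is_derive_quotientP.
have -> : (fun k => k^-1 *: (c (k + h) *: f (k + h) - c h *: f h)) =
    (fun k => c (k + h) *: (k^-1 *: (f (k + h) - f h))
              + (k^-1 *: (c (k + h) - c h)) *: f h).
  apply/funext => k; rewrite scalerA mulrC -scalerA -(scalerA k^-1).
  rewrite -scalerDr; congr (_ *: _).
  by rewrite scalerBr scalerBl addrA subrK.
by apply: cvgD; [exact: cvgZ|exact: cvgZl].
Qed.

Lemma is_derive_linear (W : normedModType R) (L : V -> W) f h v : linear L ->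
  continuous L -> is_derive h 1 f v -> is_derive h 1 (L \o f) (L v).
Proof.
move=> Ll Lc /is_derive_quotientP fv; apply/is_derive_quotientP.
pose L' : {linear V -> W} := HB.pack L (GRing.isLinear.Build _ _ _ _ L Ll).
have -> : (fun k => k^-1 *: ((L \o f) (k + h) - (L \o f) h)) =
    L \o (fun k => k^-1 *: (f (k + h) - f h)).
  apply/funext => k; rewrite /=.
  have := linearZ_LR L' k^-1 (f (k + h) - f h).
  by have := linearB L' (f (k + h)) (f h); rewrite /= => -> ->.
exact: (cvg_comp _ _ fv (Lc v)).
Qed.

End curve_derivative_operations.

(** * Semigroups and their generators *)

Section semigroup_generator.
Context {R : realType} {X : completeNormedModType R}.
Variables (D : set X) (A : X -> X) (S : R -> X -> X).
Hypotheses (semigroupS : semigroup S) (generatesS : generates D A S).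
Hypothesis boundedS : forall T : R, exists2 M, 0 <= M &
  forall (t : R) z, 0 <= t -> t <= T -> `|S t z| <= M * `|z|.

Lemma semigroupB t u v : 0 <= t -> S t (u - v) = S t u - S t v.
Proof.
move=> t0; have Sl := semigroup_linear semigroupS t0.
by rewrite -scaleN1r addrC Sl scaleN1r addrC.
Qed.

Lemma semigroupZ t c u : 0 <= t -> S t (c *: u) = c *: S t u.
Proof.
move=> t0; have Sl := semigroup_linear semigroupS t0.
by have := Sl c u (u - u); rewrite semigroupB// !subrr !addr0.
Qed.

Lemma resolvent_ex : exists w : R, forall l, w < l ->
  (forall z, exists v, is_laplace_transform S l z v) /\
  (forall z v, is_laplace_transform S l z v <-> D v /\ l *: v - A v = z).
Proof. by case: generatesS. Qed.

Definition laplace_orbit l z r : X := expR (- (l * r)) *: S r z.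

Lemma laplace_orbit_linear l r : 0 <= r -> linear (laplace_orbit l ^~ r).
Proof.
move=> r0 c u v; rewrite /laplace_orbit (semigroup_linear semigroupS r0).
by rewrite scalerDr !scalerA mulrC.
Qed.

(** Splitting the Laplace transform at [h] and shifting its tail: the truncated
    transform over [[0, h]] only sees the orbit of the transform itself. *)
Lemma laplace_transform_truncated l z v h : is_laplace_transform S l z v ->
  0 < h -> is_stieltjes_integral (laplace_orbit l z) id 0 h
             (v - laplace_orbit l v h).
Proof.
move=> [J Jint Jv] h0; suff -> : v - laplace_orbit l v h = J h by exact: Jint.
have Lc : continuous (laplace_orbit l ^~ h).
  by move=> u; apply: cvgZr; exact: (semigroup_bounded semigroupS (ltW h0)).
have SJ tau : 0 < tau -> laplace_orbit l (J tau) h = J (tau + h) - J h.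
  move=> tau0; have th0 : 0 < tau + h by rewrite addr_gt0.
  have hth : h <= tau + h by rewrite lerDr ltW.
  apply: (stieltjes_integral_unique hth); last first.
    exact: stieltjes_integralB (ltW h0) (Jint _ h0) (Jint _ th0).
  have := stieltjes_integral_linear (laplace_orbit_linear l (ltW h0)) _
    (Jint _ tau0).
  move=> /(_ Lc)/(@riemann_integral_shift _ _ _ h); rewrite add0r.
  apply: eq_stieltjes_integral => r hr _.
  have rh0 : 0 <= r - h by rewrite subr_ge0.
  rewrite /= /laplace_orbit semigroupZ ?(ltW h0)// scalerA -expRD.
  rewrite -semigroupD ?(ltW h0)// subrKC.
  by congr (expR _ *: _); ring.
have H1 : laplace_orbit l (J tau) h @[tau --> +oo] --> laplace_orbit l v h.
  exact: (cvg_comp _ _ Jv (Lc v)).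
have H2 : J (tau + h) - J h @[tau --> +oo] --> v - J h.
  apply: cvgB; last exact: cvg_cst.
  apply: (cvg_comp (fun tau => tau + h) J _ Jv).
  apply/cvgryPge => B; near=> t; rewrite -lerBlDr; near: t.
  by apply: nbhs_pinfty_ge; exact: num_real.
have : laplace_orbit l v h = v - J h.
  apply: (cvg_unique (@norm_hausdorff _ X) H1).
  apply: cvg_trans H2; apply: near_eq_cvg; near=> tau; symmetry; apply: SJ.
  by near: tau; apply: nbhs_pinfty_gt; exact: num_real.
by move=> ->; rewrite opprB addrC subrK.
Unshelve. all: by end_near. Qed.

Lemma laplace_orbit_bounded l h : exists2 C, 0 <= C & forall z r,
  0 <= r -> r <= h -> `|laplace_orbit l z r| <= C * `|z|.
Proof.
have [M M0 SM] := boundedS h; exists (expR (`|l| * h) * M).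
  by rewrite mulr_ge0// expR_ge0.
move=> z r r0 rh; rewrite normrZ ger0_norm ?expR_ge0// -mulrA.
rewrite ler_pM ?expR_ge0//; last exact: SM.
rewrite ler_expR -mulNr (le_trans (ler_norm _))// normrM normrN (ger0_norm r0).
by rewrite ler_wpM2l.
Qed.

(** With a constant weighted orbit, the truncated transforms are [tau *: d]; they
    converge as [tau] grows only if [d = 0]. *)
Lemma laplace_orbit_fixed l d : (exists v, is_laplace_transform S l d v) ->
  (forall h, 0 < h -> laplace_orbit l d h = d) -> d = 0.
Proof.
move=> [v [J Jint Jv]] dfix.
have JE tau : 0 < tau -> J tau = tau *: d.
  move=> tau0; apply/subr0_eq/eqP; rewrite -normr_le0.
  have /(_ d 0) := riemann_integral_approx (ltW tau0) _ (Jint _ tau0).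
  rewrite subr0 mul0r; apply => r; rewrite le_eqVlt => /predU1P[<- _|r0 _].
    by rewrite mulr0 oppr0 expR0 scale1r (semigroup0 semigroupS) subrr normr0.
  by rewrite [X in X - _]dfix// subrr normr0.
have H : J (tau + 1) - J tau @[tau --> +oo] --> v - v.
  apply: cvgB; last exact: Jv.
  apply: (cvg_comp (fun tau => tau + 1) J _ Jv).
  apply/cvgryPge => B; near=> t; rewrite -lerBlDr; near: t.
  by apply: nbhs_pinfty_ge; exact: num_real.
rewrite subrr in H; apply: (cvg_unique (@norm_hausdorff _ X) _ H).
apply: cvg_near_cst; near=> tau.
have tau0 : 0 < tau by near: tau; apply: nbhs_pinfty_gt; exact: num_real.
by rewrite !JE ?addr_gt0// -scalerBl addrAC subrr add0r scale1r.
Unshelve. all: by end_near. Qed.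

Lemma generatorB u v : D u -> D v -> D (u - v) /\ A (u - v) = A u - A v.
Proof.
have [[D0 Dl Al] _] := generatesS => Du Dv.
have -> : u - v = -1 *: v + u by rewrite scaleN1r addrC.
by split; [exact: Dl|rewrite Al// scaleN1r addrC].
Qed.

Lemma generatorD u v : D u -> D v -> D (u + v) /\ A (u + v) = A u + A v.
Proof.
have [[D0 Dl Al] _] := generatesS => Du Dv.
have -> : u + v = 1 *: u + v by rewrite scale1r.
by split; [exact: Dl|rewrite Al// scale1r].
Qed.

(** Let [v'] be the resolvent at [l] of [l u - v]. The truncated transforms pass
    to the limit along the sequence, because only bounded times are involved,
    and show that [d = u - v'] satisfies [S h d = exp (l h) d] for all [h > 0].
    The Laplace transform of such a [d] diverges at [l], unless [d = 0]. *)
Lemma generator_closed (u_ : nat -> X) u v : (forall n, D (u_ n)) ->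
  u_ n @[n --> \oo] --> u -> A (u_ n) @[n --> \oo] --> v -> D u /\ A u = v.
Proof.
move=> Du_ u_u Au_v; have [w wl] := resolvent_ex.
have {wl}[lex lP] := wl (w + 1) ltac:(by rewrite ltrDl).
set l := w + 1 in lex lP; pose g := l *: u - v.
have [v' gv'] := lex g; have [Dv' Av'] := (lP _ _).1 gv'.
suff uv' : u = v'.
  by rewrite uv'; split => //; apply: (addrI (- (l *: v'))); apply: oppr_inj;
    rewrite !opprD !opprK Av' /g uv'.
apply/subr0_eq/(laplace_orbit_fixed (lex _)) => h h0.
apply/esym/subr0_eq/eqP; rewrite -normr_le0.
have [C C0 SC] := laplace_orbit_bounded l h.
have bound n : `|u_ n - v' - laplace_orbit l (u_ n - v') h|
    <= C * `|l *: u_ n - A (u_ n) - g| * h.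
  have [Dd Ad] := generatorB (Du_ n) Dv'.
  have /(laplace_transform_truncated)/(_ h0) : is_laplace_transform S l
      (l *: u_ n - A (u_ n) - g) (u_ n - v').
    apply/lP; split => //; rewrite Ad -Av' scalerBr !opprD !opprK.
    by rewrite addrACA.
  move=> dint; have /(_ 0) := riemann_integral_approx (ltW h0) _ dint.
  rewrite scaler0 !subr0; apply => r r0 rh; rewrite subr0.
  exact: SC.
have rhs0 : C * `|l *: u_ n - A (u_ n) - g| * h @[n --> \oo] --> (0 : R).
  rewrite -[X in _ --> X](mul0r h); apply: cvgMl.
  rewrite -[X in _ --> X](mulr0 C); apply: cvgMr.
  apply/norm_cvg0P; rewrite -[X in _ --> X](subrr g); apply: cvgB.
    by apply: cvgB => //; exact: cvgZr.
  exact: cvg_cst.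
have lhs : `|u_ n - v' - laplace_orbit l (u_ n - v') h| @[n --> \oo] -->
    `|u - v' - laplace_orbit l (u - v') h|.
  apply: cvg_norm; apply: cvgB; first by apply: cvgB => //; exact: cvg_cst.
  apply: cvgZr; apply: cvg_comp; last first.
    exact: (semigroup_bounded semigroupS (ltW h0)).
  by apply: cvgB => //; exact: cvg_cst.
apply: ler_cvg_to lhs rhs0 _; exact: nearW.
Qed.

Lemma laplace_orbit_integral l z v a b : is_laplace_transform S l z v ->
  0 < a -> a < b ->
  is_stieltjes_integral (laplace_orbit l z) id a b
    (laplace_orbit l v a - laplace_orbit l v b).
Proof.
move=> zv a0 ab; have b0 := lt_trans a0 ab.
have := stieltjes_integralB (ltW a0) (laplace_transform_truncated zv a0)
  (laplace_transform_truncated zv b0).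
by rewrite opprB addrC addrA subrK addrC.
Qed.

Lemma laplace_orbit_continuous l z (h : R) : 0 < h ->
  {for h, continuous (laplace_orbit l z)}.
Proof.
move=> h0; apply: cvgZ; last exact: semigroup_strongly_continuous.
apply: (continuous_comp (f := fun r => - (l * r)) (g := expR)).
  by apply: cvgN; apply: cvgMr; exact: cvg_id.
exact: continuous_expR.
Qed.

(** The orbit of the resolvent is, up to a constant, the integral of a
    continuous function on the open half-line. *)
Lemma laplace_orbit_derive l z v (h : R) :
  is_laplace_transform S l z v -> 0 < h ->
  is_derive h 1 (laplace_orbit l v) (- laplace_orbit l z h).
Proof.
move=> zv h0; apply: is_derive_increment => e e0.
have /cvgrPdist_le/(_ e e0)[d /= d0 dP] :=
  laplace_orbit_continuous (l := l) (z := z) h0.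
exists (Num.min d h); first by rewrite lt_min d0.
move=> k k0; rewrite lt_min => /andP[kd kh].
have near_h r : `|h - r| <= `|k| ->
    `|laplace_orbit l z r - laplace_orbit l z h| <= e.
  by move=> hr; rewrite distrC; apply: dP; rewrite /= (le_lt_trans hr).
rewrite scalerN opprK; have [kneg|kpos|/eqP] := ltgtP k 0; last first.
- by rewrite (negbTE k0).
- rewrite ltr_norml in kh; rewrite gtr0_norm// in near_h *.
  have hk : h < k + h by rewrite ltrDr.
  have := riemann_integral_approx (e := e) (z := laplace_orbit l z h) (ltW hk) _
    (laplace_orbit_integral zv h0 hk).
  rewrite addrK (distrC (_ - _)) opprB (addrC (k *: _)); apply => r hr rh.
  by apply: near_h; rewrite ler0_norm ?subr_le0// opprB lerBlDr.
- rewrite ltr_norml in kh; rewrite ltr0_norm// in near_h *.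
  have hk : k + h < h by rewrite gtrDr.
  have kh0 : 0 < k + h by lra.
  have := riemann_integral_approx (e := e) (z := laplace_orbit l z h) (ltW hk) _
    (laplace_orbit_integral zv kh0 hk).
  rewrite opprD addrCA subrr addr0 scaleNr opprK; apply => r hr rh.
  by apply: near_h; rewrite ger0_norm ?subr_ge0//; lra.
Qed.

Lemma orbit_derive_domain z (h : R) : D z -> 0 < h ->
  is_derive h 1 (S ^~ z) (S h (A z)).
Proof.
move=> Dz h0; have [w wl] := resolvent_ex.
have {wl}[_ lP] := wl (w + 1) ltac:(by rewrite ltrDl).
set l := w + 1 in lP.
have /(lP _ _).2 zv : D z /\ l *: z - A z = l *: z - A z by [].
have eE : is_derive h 1 (fun r => expR (l * r)) (l * expR (l * h)).
  have := @is_derive1_comp R expR (fun r => l * r) h _ _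
    (is_derive_expR _) (is_deriveZ _ (is_derive_id _ _)).
  by rewrite /GRing.scale /= mulr1 mulrC.
have := is_derive_scale eE (laplace_orbit_derive zv h0).
have -> : (fun r => expR (l * r) *: laplace_orbit l z r) = S ^~ z.
  apply/funext => r.
  by rewrite /laplace_orbit scalerA -expRD subrr expR0 scale1r.
congr is_derive; rewrite /laplace_orbit scalerN !scalerA -expRD subrr expR0.
rewrite scale1r -mulrA -expRD subrr expR0 mulr1 semigroupB ?(ltW h0)//.
by rewrite semigroupZ ?(ltW h0)// opprB subrK.
Qed.

(** The semigroup commutes with the Laplace transforms, hence with the
    resolvents. *)
Lemma semigroup_generator_commute z (t : R) : D z -> 0 <= t ->
  D (S t z) /\ A (S t z) = S t (A z).
Proof.
move=> Dz t0; have [w wl] := resolvent_ex.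
have {wl}[_ lP] := wl (w + 1) ltac:(by rewrite ltrDl).
set l := w + 1 in lP.
have /(lP _ _).2 zv : D z /\ l *: z - A z = l *: z - A z by [].
suff /(lP _ _).1[DSz ASz] :
    is_laplace_transform S l (S t (l *: z - A z)) (S t z).
  split => //; apply: (addrI (- (l *: S t z))); apply: oppr_inj.
  by rewrite !opprD !opprK ASz semigroupB// semigroupZ.
have [J Jint Jz] := zv; have Sc := semigroup_bounded semigroupS t0.
exists (S t \o J) => [tau tau0|]; last exact: (cvg_comp _ _ Jz (Sc z)).
have := stieltjes_integral_linear (semigroup_linear semigroupS t0) Sc
  (Jint _ tau0).
apply: eq_stieltjes_integral => r r0 _.
by rewrite /= semigroupZ// -!(semigroupD semigroupS)// addrC.
Qed.

Hypothesis smoothingS : forall (t : R) z, 0 < t -> D (S t z).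

Lemma generator_orbit_shift z (d r : R) : 0 < d -> d <= r ->
  A (S r z) = S (r - d) (A (S d z)).
Proof.
move=> d0 dr; have rd : 0 <= r - d by rewrite subr_ge0.
rewrite -(semigroup_generator_commute (smoothingS z d0) rd).2.
by rewrite -(semigroupD semigroupS) ?(ltW d0)// subrK.
Qed.

(** An orbit enters the domain at once, where it is differentiable: restart it
    at time [r / 2]. *)
Lemma orbit_derive z (r : R) : 0 < r -> is_derive r 1 (S ^~ z) (A (S r z)).
Proof.
move=> r0; have d0 : 0 < r / 2 by rewrite divr_gt0.
have dr : r - r / 2 = r / 2 by lra.
have := orbit_derive_domain (smoothingS z d0) d0.
have dler : r / 2 <= r by lra.
rewrite (generator_orbit_shift z d0 dler) dr.
move=> /is_derive_quotientP H; apply/is_derive_quotientP; apply: cvg_trans H.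
apply: near_eq_cvg; near=> k.
have kd : 0 <= k + r / 2.
  have : `|k| < r / 2 by near: k; exact: dnbhs0_lt.
  by rewrite ltr_norml => /andP[H _]; lra.
rewrite -!(semigroupD semigroupS) ?(ltW d0)//.
by congr (_ *: (S _ _ - S _ _)); lra.
Unshelve. all: by end_near. Qed.

Lemma generator_orbit_continuous z (r : R) : 0 < r ->
  {for r, continuous (fun t => A (S t z))}.
Proof.
move=> r0; have d0 : 0 < r / 2 by rewrite divr_gt0.
have dr : r / 2 <= r by lra.
rewrite /prop_for /continuous_at (generator_orbit_shift z d0 dr).
have rd0 : 0 < r - r / 2 by lra.
have Sc := semigroup_strongly_continuous semigroupS (z := A (S (r / 2) z)) rd0.
have : S (t - r / 2) (A (S (r / 2) z)) @[t --> r] -->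
    S (r - r / 2) (A (S (r / 2) z)).
  apply: (cvg_comp (fun t => t - r / 2) (S ^~ (A (S (r / 2) z))) _ Sc).
  by apply: cvgB; [exact: cvg_id|exact: cvg_cst].
apply: cvg_trans; apply: near_eq_cvg; near=> t.
apply/esym/generator_orbit_shift => //; near: t.
by exists (r / 2) => // t' /=; rewrite ltr_distlC => /andP[]; lra.
Unshelve. all: by end_near. Qed.

Lemma generator_orbit_bound z (t tau C : R) : 0 < t -> 0 < tau ->
  (forall k, 0 < k -> k <= tau -> `|S k (S t z) - S t z| <= C * k) ->
  `|A (S t z)| <= C.
Proof.
move=> t0 tau0 H; have := orbit_derive z t0.
move=> /is_derive_quotientP/cvg_dnbhs_at_right/cvg_norm.
move=> /cvgr_to_le; apply; near=> k.
have k0 : 0 < k by near: k; exact: nbhs_right_gt.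
rewrite normrZ normfV (gtr0_norm k0) mulrC ler_pdivrMr//.
rewrite (semigroupD semigroupS) ?(ltW t0) ?(ltW k0)//; apply: H => //.
by near: k; exact: nbhs_right_le.
Unshelve. all: by end_near. Qed.

End semigroup_generator.

(** * Geometric series and powers *)

Section geometric_limits.
Context {R : realType} {V : completeNormedModType R}.

Lemma geometric_limit (w : nat -> V) (c q : R) : 0 <= q -> q < 1 -> w 0 = 0 ->
  (forall n, `|w n.+1 - w n| <= c * q ^+ n) ->
  exists2 l, w n @[n --> \oo] --> l & `|l| <= c / (1 - q).
Proof.
move=> q0 q1 w0 H; have q1' : 0 < 1 - q by rewrite subr_gt0.
have c0 : 0 <= c by have := le_trans (normr_ge0 _) (H 0%N); rewrite expr0 mulr1.
have bound n : `|w n| <= c / (1 - q).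
  suff : `|w n| <= c / (1 - q) * (1 - q ^+ n).
    move=> /le_trans; apply; rewrite ler_piMr ?divr_ge0 ?(ltW q1')//.
    by rewrite gerBl exprn_ge0.
  elim: n => [|n ih]; first by rewrite w0 normr0 expr0 subrr mulr0.
  rewrite -(subrK (w n) (w n.+1)) (le_trans (ler_normD _ _))//.
  apply: le_trans (lerD (H n) ih) _.
  rewrite le_eqVlt exprS; apply/orP; left; apply/eqP; field.
  by rewrite gt_eqF.
have wE : series (telescope w) = w.
  by rewrite telescopeK; apply/funext => n /=; rewrite w0 subr0.
have : cvgn (series (telescope w)).
  apply: normed_cvg.
  apply: (@series_le_cvg _ _ (geometric c q)) => [n|n|n|].
  - exact: normr_ge0.
  - by rewrite /= mulr_ge0 ?exprn_ge0.
  - exact: H.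
  - by apply: is_cvg_geometric_series; rewrite ger0_norm.
rewrite wE => /cvg_ex[l wl]; exists l => //.
by apply: (cvgr_to_le (cvg_norm wl)); exact: nearW.
Qed.

End geometric_limits.

Section powers.
Context {R : realType}.
Implicit Types (a b e : R).

Lemma powR_le_exp a b e : 0 <= e -> 0 <= a -> a <= b -> a `^ e <= b `^ e.
Proof.
by move=> e0 a0 ab; apply: ge0_ler_powR; rewrite ?nnegrE// (le_trans a0).
Qed.

Lemma powR_ge_exp a b e : e <= 0 -> 0 < a -> a <= b -> b `^ e <= a `^ e.
Proof.
move=> e0 a0 ab; rewrite -(opprK e) !(powRN _ (- e)).
rewrite lef_pV2 ?posrE ?powR_gt0 ?(lt_le_trans a0)//.
by rewrite powR_le_exp ?oppr_ge0// ltW.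
Qed.

Lemma powR_halfn (h e : R) n : 0 <= h ->
  (h / 2 ^+ n) `^ e = (2^-1 `^ e) ^+ n * h `^ e.
Proof.
move=> h0; elim: n => [|n ih]; first by rewrite !expr0 divr1 mul1r.
by rewrite !exprS invfM mulrCA mulrC powR_half ?divr_ge0 ?exprn_ge0// ih mulrA.
Qed.

Lemma powRDpos a e e' : 0 < a -> a `^ (e + e') = a `^ e * a `^ e'.
Proof. by move=> a0; rewrite powRD// (gt_eqF a0) implybT. Qed.

Lemma powR_small C a e : 0 <= C -> 0 < a -> 0 < e ->
  exists2 d, 0 < d & forall h, 0 <= h -> h <= d -> C * h `^ a <= e.
Proof.
move=> C0 a0 e0; have C1 : 0 < C + 1 by rewrite ltr_wpDl.
have eC : 0 < e / (C + 1) by rewrite divr_gt0.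
exists ((e / (C + 1)) `^ a^-1) => [|h h0 hd]; first exact: powR_gt0.
apply: le_trans (ler_wpM2l C0 (powR_le_exp (ltW a0) h0 hd)) _.
rewrite -powRrM mulVf ?gt_eqF// powRr1 ?(ltW eC)// mulrCA ler_piMr ?(ltW e0)//.
by rewrite ler_pdivrMr// mul1r lerDl.
Qed.

End powers.

(** * The scale of spaces *)

Section structural_consequences.
Context {R : realType} {X : completeNormedModType R}.
Variables (D : set X) (A : X -> X) (S : R -> X -> X).
Variable Xs : R -> banach_subspace X.
Hypothesis structural : structural_assumptions D A S Xs.

Let semigroupS := structural_semigroup structural.
Let generatesS := structural_generator structural.

Let lt12 : 1 < 2 :> R. Proof. by rewrite ltr1n. Qed.

Lemma scale0_setT z : Xs 0 z.
Proof. by rewrite (scale0 (structural_scale structural)). Qed.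

Lemma semigroup_bounded_near0 T : exists2 M : R, 0 <= M &
  forall (t : R) z, 0 <= t -> t <= T -> `|S t z| <= M * `|z|.
Proof.
(* [T] may be nonpositive. *)
have T0 : 0 < Num.max T 1 by rewrite lt_max ltr01 orbT.
have [M M0 H] :=
  structural_smoothing structural T0 (lexx 0) (lexx 0) (ltr0Sn R 1).
exists (1 + M) => [|t z]; first by rewrite addr_ge0// ltW.
rewrite le_eqVlt => /predU1P[<- _|t0 tT].
  by rewrite (semigroup0 semigroupS) mulrDl mul1r lerDl mulr_ge0// ltW.
have tT' : t <= Num.max T 1 by rewrite le_max tT.
have [_] := H t t0 tT' z (scale0_setT z).
rewrite !(scale0_norm (structural_scale structural)) oppr0 addr0 powRr0 mulr1.
by move=> /le_trans; apply; rewrite mulrDl mul1r lerDr.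
Qed.

Lemma semigroup_in_domain (t : R) z : 0 < t -> D (S t z).
Proof.
move=> t0; have [M M0 H] := structural_smoothing structural t0 (lexx 0) ler01
  lt12.
have [+ _] := H t t0 (lexx t) z (scale0_setT z).
by rewrite (scale1 (structural_scale structural)).
Qed.

(** On the range of [S t], the operator [A] is the derivative of the orbits, so
    that the bound of [S k - I] from [X_1] to [X_0], linear in [k], controls
    [A] by the norm of [X_1]. *)
Lemma generator_smoothing T zeta : 0 < T -> 0 <= zeta -> zeta <= 1 ->
  exists2 C, 0 <= C & forall t z, 0 < t -> t <= T -> Xs zeta z ->
    `|A (S t z)| <= C * t `^ (zeta - 1) * bs_norm (Xs zeta) z.
Proof.
move=> T0 z0 z1.
have [M M0 HM] := structural_smoothing structural T0 z0 z1
  lt12.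
have [C C0 HC] := structural_approx structural T0 (lexx 0) ltr01 (lexx 1).
exists (C * M) => [|t z t0 tT Xz]; first by rewrite mulr_ge0// ltW.
apply: (generator_orbit_bound semigroupS generatesS semigroup_in_domain t0 T0).
move=> k k0 kT.
have [X1 X1M] := HM t t0 tT z Xz.
have [_] := HC k k0 kT _ X1.
rewrite (scale0_norm (structural_scale structural)) subr0 powRr1 ?(ltW k0)//.
move=> /le_trans; apply; rewrite mulrAC ler_wpM2r ?(ltW k0)//.
by rewrite -!mulrA ler_wpM2l ?(ltW C0)// mulrA (addrC zeta).
Qed.

Lemma scale_embeddingX zeta : 0 <= zeta -> zeta < 2 ->
  exists2 c, 0 <= c & forall z, Xs zeta z -> `|z| <= c * bs_norm (Xs zeta) z.
Proof.
move=> z0 z2.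
have [c H] := scale_embedding (structural_scale structural) (lexx 0) z0 z2.
exists `|c| => // z Xz; have [_] := H z Xz.
rewrite (scale0_norm (structural_scale structural)) => /le_trans; apply.
by rewrite ler_wpM2r ?ler_norm// bs_norm_ge0.
Qed.

Lemma semigroup_approx_id T zeta : 0 < T -> 0 < zeta -> zeta <= 1 ->
  exists2 C, 0 <= C & forall h z, 0 < h -> h <= T -> Xs zeta z ->
    `|S h z - z| <= C * h `^ zeta * bs_norm (Xs zeta) z.
Proof.
move=> T0 z0 z1.
have [C C0 HC] := structural_approx structural T0 (lexx 0) z0 z1.
exists C => [|h z h0 hT Xz]; first exact: ltW.
have [_] := HC h h0 hT _ Xz.
by rewrite (scale0_norm (structural_scale structural)) subr0.
Qed.

End structural_consequences.

Section banach_subspace_lemmas.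
Context {R : realType} {X : completeNormedModType R}.
Variable E : banach_subspace X.

Lemma bs_setB u v : E u -> E v -> E (u - v).
Proof.
move=> Eu Ev; rewrite addrC -scaleN1r; exact: bs_set_linear.
Qed.

Lemma bs_norm_triangle u v : E u -> E v ->
  bs_norm E u <= bs_norm E (u - v) + bs_norm E v.
Proof. by move=> Eu Ev; rewrite -{1}(subrK v u) bs_normD//; exact: bs_setB. Qed.

Lemma bs_normC u v : E u -> E v -> bs_norm E (u - v) = bs_norm E (v - u).
Proof.
move=> Eu Ev; rewrite -(opprB v u) -scaleN1r bs_normZ ?normrN1 ?mul1r//.
exact: bs_setB.
Qed.

Lemma continuous_into_bounded (a b : R) (f : R -> X) : a <= b ->
  continuous_into E `[a, b] f ->
  exists2 N, 0 <= N & forall r, a <= r -> r <= b ->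
    E (f r) /\ bs_norm E (f r) <= N.
Proof.
move=> ab [Ef fc].
have nc : {within `[a, b], continuous (fun r => bs_norm E (f r))}.
  apply/subspace_continuousP => r rab; apply/cvgrPdist_le => e e0.
  have /cvgrPdist_le/(_ e e0) := fc r rab.
  rewrite !near_withinE; apply: filterS => q /[swap] qab /(_ qab).
  rewrite sub0r normrN ger0_norm; last exact/bs_norm_ge0/bs_setB/Ef/rab/Ef.
  move=> qe; rewrite ler_norml; apply/andP; split.
    rewrite lerBrDr -lerBrDl opprK addrC.
    apply: le_trans (bs_norm_triangle (Ef _ qab) (Ef _ rab)) _.
    by rewrite lerD2r.
  rewrite lerBlDr; apply: le_trans (bs_norm_triangle (Ef _ rab) (Ef _ qab)) _.
  by rewrite bs_normC ?lerD2r//; exact: Ef.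
have [c cab cmax] := EVT_max ab nc.
exists (bs_norm E (f c)); first by apply/bs_norm_ge0/Ef.
move=> r ar rb; have rab : r \in `[a, b] by rewrite in_itv/= ar.
by split; [exact/Ef|exact: cmax].
Qed.

End banach_subspace_lemmas.

(** * Regularity of mild solutions *)

Section mild_solutions.
Context {R : realType} {X : completeNormedModType R}.
Variables (D : set X) (A : X -> X) (S : R -> X -> X).
Variables (Xs : R -> banach_subspace X) (T eta alpha : R) (x : R -> R).
Variables (sigma : X -> X) (psi : X) (y : R -> X).
Hypothesis T0 : 0 < T.
Hypothesis structural : structural_assumptions D A S Xs.
Hypothesis eta0 : 0 < eta.
Hypothesis x_holder : holder_on 0 T eta x.
Hypotheses (alpha0 : 0 < alpha) (alpha1 : alpha < 1).
Hypothesis young : 1 < alpha + eta.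
Hypothesis sigmaP : sigma_assumptions Xs alpha sigma.
Hypothesis mild : mild_solution S Xs sigma x psi T alpha y.
Hypothesis y_regular : hat_C S (Xs alpha) 0 T alpha y.

Let semigroupS := structural_semigroup structural.
Let generatesS := structural_generator structural.
Let boundedS := semigroup_bounded_near0 structural.
Let domainS := semigroup_in_domain structural.
Let alpha2 : alpha < 2. Proof. by rewrite (lt_trans alpha1)// ltr1n. Qed.

Lemma driver_holder : exists2 K, 0 <= K & forall u v, 0 <= u -> u < v ->
  v <= T -> `|x v - x u| <= K * (v - u) `^ eta.
Proof.
have [K H] := x_holder; exists `|K| => // u v u0 uv vT.
have vu : 0 < v - u by rewrite subr_gt0.
have uT : u <= T by rewrite (le_trans (ltW uv)).
have v0 : 0 <= v by rewrite (le_trans u0)// ltW.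
have := H u v u0 uT v0 vT; rewrite (gtr0_norm vu) => /le_trans; apply.
by rewrite ler_wpM2r ?powR_ge0 ?ler_norm.
Qed.

Lemma solution_bounded : exists2 N, 0 <= N & forall r, 0 <= r -> r <= T ->
  Xs alpha (y r) /\ bs_norm (Xs alpha) (y r) <= N.
Proof. exact: continuous_into_bounded (ltW T0) y_regular.1. Qed.

Lemma coefficient_bounded : exists2 N, 0 <= N & forall r, 0 <= r -> r <= T ->
  Xs alpha (sigma (y r)) /\ bs_norm (Xs alpha) (sigma (y r)) <= N.
Proof.
have [N N0 yN] := solution_bounded; have [L L0 H] := sigma_growth sigmaP.
exists (L * (1 + N)) => [|r r0 rT].
  by rewrite mulr_ge0 ?(ltW L0) ?addr_ge0.
have [Xy yr] := yN r r0 rT; split; first exact: (sigma_stable sigmaP).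
by apply: le_trans (H _ Xy) _; rewrite ler_wpM2l ?(ltW L0)// lerD2l.
Qed.

(** The remainder of [y] on [[u, v]] after transport by the semigroup; it
    equals the Young convolution over [[u, v]]. *)
Definition increment (u v : R) : X := y v - S (v - u) (y u).

(** The convolution over [[0, v]], minus the part over [[0, u]] transported by
    [S (v - u)]. *)
Lemma increment_integral u v : 0 <= u -> u < v -> v <= T ->
  is_stieltjes_integral (fun r => S (v - r) (sigma (y r))) x u v
    (increment u v).
Proof.
move=> u0 uv vT; have [_ H] := mild.
have uT : u <= T by rewrite (le_trans (ltW uv)).
have v0 : 0 <= v by rewrite (le_trans u0)// ltW.
have vu0 : 0 <= v - u by rewrite subr_ge0 ltW.
have [Vu /= Vuint yu] := H u u0 uT; have [Vv Vvint yv] := H v v0 vT.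
have -> : increment u v = Vv - S (v - u) Vu.
  rewrite /increment yu yv.
  have Sl := semigroup_linear semigroupS vu0.
  have := Sl 1 (S u psi) Vu; rewrite !scale1r => ->.
  by rewrite -(semigroupD semigroupS)// subrK opprD addrACA subrr add0r.
apply: (stieltjes_integralB u0 _ Vvint).
have := stieltjes_integral_linear (semigroup_linear semigroupS vu0)
  (semigroup_bounded semigroupS vu0) Vuint.
apply: eq_stieltjes_integral => r r0 ru /=.
have ur0 : 0 <= u - r by rewrite subr_ge0 ltW.
by rewrite -(semigroupD semigroupS)// addrA subrK.
Qed.

Lemma coefficient_holder : exists2 K, 0 <= K & forall u v, 0 <= u -> u < v ->
  v <= T -> `|sigma (y v) - S (v - u) (sigma (y u))| <= K * (v - u) `^ alpha.
Proof.
have [[_ [_ [K H]]] _] := mild; exists `|K| => // u v u0 uv vT.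
have := H (u, v) (And3 u0 uv vT).
rewrite (scale0_norm (structural_scale structural)) /hat_delta1 /=.
rewrite opprB addrA subrK => /le_trans; apply.
by rewrite ler_wpM2r ?powR_ge0 ?ler_norm.
Qed.

Let theta := alpha + eta.

(** Young's estimate for the convolution: it is applied to the integrand
    [S (v - r) (sigma (y r))], whose increments are the transported reduced
    increments of [sigma \o y]. *)
Lemma increment_estimate : exists2 C, 0 <= C & forall u v, 0 <= u -> u < v ->
  v <= T ->
  `|increment u v - (x v - x u) *: S (v - u) (sigma (y u))|
    <= C * (v - u) `^ theta.
Proof.
have [M M0 SM] := boundedS T; have [K K0 xK] := driver_holder.
have [H H0 sH] := coefficient_holder.
have r1 : 0 < 1 - sewing_ratio theta by rewrite subr_gt0 sewing_ratio_lt1.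
exists (K * (M * H) / (1 - sewing_ratio theta)) => [|u v u0 uv vT].
  by rewrite divr_ge0 ?(ltW r1) ?mulr_ge0.
apply: (young_estimate young _ uv (increment_integral u0 uv vT)).
move=> a b ua ab bv; set m := (a + b) / 2.
have am : a < m by rewrite /m; lra.
have mb : m < b by rewrite /m; lra.
have a0 := le_trans u0 ua; have mv := lt_le_trans mb bv.
have mT : m <= T by rewrite (le_trans (ltW mv)).
have vm : 0 <= v - m by rewrite subr_ge0 ltW.
have -> : v - a = v - m + (m - a) by rewrite addrA subrK.
have ma0 : 0 <= m - a by rewrite subr_ge0 ltW.
rewrite (@semigroupD _ _ _ semigroupS (v - m) (m - a))//.
rewrite -(semigroupB semigroupS)// normrZ (addrC alpha) powRDpos ?subr_gt0//.
rewrite [leRHS](_ : _ =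
  (K * (b - a) `^ eta) * (M * (H * (b - a) `^ alpha))); last ring.
have m0 : 0 <= m := le_trans a0 (ltW am).
apply: ler_pM => //.
  apply: le_trans (xK _ _ m0 mb (le_trans bv vT)) _.
  rewrite ler_wpM2l// powR_le_exp ?(ltW eta0)// ?subr_ge0 ?(ltW mb)//.
  by rewrite lerB// ltW.
apply: le_trans (SM _ _ vm _) _; first by rewrite (le_trans _ vT)// gerBl.
rewrite ler_wpM2l//; apply: le_trans (sH _ _ a0 am mT) _.
rewrite ler_wpM2l// powR_le_exp ?(ltW alpha0)// ?subr_ge0 ?(ltW am)//.
by rewrite lerB// ltW.
Qed.

(** The semigroup in the main term is removed at the cost
    [(v - u) `^ alpha], by the regularity of [sigma (y u)] in [X_alpha]. *)
Lemma increment_estimate0 : exists2 C, 0 <= C & forall u v, 0 <= u -> u < v ->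
  v <= T -> `|increment u v - (x v - x u) *: sigma (y u)|
    <= C * (v - u) `^ theta.
Proof.
have [C C0 IC] := increment_estimate; have [K K0 xK] := driver_holder.
have [N N0 sN] := coefficient_bounded.
have [E E0 SE] := semigroup_approx_id structural T0 alpha0 (ltW alpha1).
exists (C + K * (E * N)) => [|u v u0 uv vT].
  by rewrite addr_ge0 ?mulr_ge0.
have vu : 0 < v - u by rewrite subr_gt0.
have uT : u <= T by rewrite (le_trans (ltW uv)).
have vuT : v - u <= T by rewrite (le_trans _ vT)// gerBl.
rewrite -(subrKA ((x v - x u) *: S (v - u) (sigma (y u)))).
rewrite (le_trans (ler_normD _ _))// mulrDl lerD//; first exact: IC.
rewrite -scalerBr normrZ /theta (addrC alpha) powRDpos//.
rewrite [leRHS](_ : _ =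
  (K * (v - u) `^ eta) * (E * (v - u) `^ alpha * N)); last ring.
have [Xs_ sle] := sN u u0 uT.
apply: ler_pM => //; first exact: xK.
apply: le_trans (SE _ _ vu vuT Xs_) _.
by rewrite ler_wpM2l// mulr_ge0 ?powR_ge0.
Qed.

Lemma increment_vanishes : exists2 C, 0 <= C & forall u v, 0 <= u -> u < v ->
  v <= T -> `|increment u v| <= C * (v - u) `^ eta.
Proof.
have [C C0 IC] := increment_estimate0; have [K K0 xK] := driver_holder.
have [N N0 sN] := coefficient_bounded.
have [c c0 Xc] := scale_embeddingX structural (ltW alpha0) alpha2.
exists (C * T `^ alpha + K * (c * N)) => [|u v u0 uv vT].
  by rewrite addr_ge0 ?mulr_ge0 ?powR_ge0.
have vu : 0 < v - u by rewrite subr_gt0.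
have uT : u <= T by rewrite (le_trans (ltW uv)).
have vuT : v - u <= T by rewrite (le_trans _ vT)// gerBl.
rewrite -(subrK ((x v - x u) *: sigma (y u)) (increment u v)).
rewrite (le_trans (ler_normD _ _))// mulrDl lerD//.
  apply: le_trans (IC _ _ u0 uv vT) _; rewrite /theta powRDpos// -mulrA.
  rewrite ler_wpM2l// ler_wpM2r ?powR_ge0//.
  by rewrite powR_le_exp ?(ltW alpha0) ?(ltW vu).
have [Xs_ sle] := sN u u0 uT.
rewrite normrZ mulrAC; apply: ler_pM => //; first exact: xK.
by apply: le_trans (Xc _ Xs_) _; rewrite ler_wpM2l.
Qed.

Lemma increment_split u m v : u <= m -> m <= v ->
  increment u v = S (v - m) (increment u m) + increment m v.
Proof.
move=> um mv; rewrite /increment (semigroupB semigroupS) ?subr_ge0//.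
rewrite -(semigroupD semigroupS) ?subr_ge0//.
have -> : v - m + (m - u) = v - u by rewrite addrA subrK.
by rewrite [RHS]addrC addrA subrK.
Qed.

(** At distance [k] from the end point, transport by [S k] smoothes the
    increment over [[u, u + k]]: the main term through the regularity of
    [sigma (y u)], the remainder through its size [k `^ theta]. *)
Lemma generator_increment_step : exists2 C, 0 <= C & forall u k, 0 <= u ->
  0 < k -> u + k + k <= T ->
  `|A (S k (increment u (u + k)))| <= C * k `^ (theta - 1).
Proof.
have [C C0 IC] := increment_estimate; have [K K0 xK] := driver_holder.
have [N N0 sN] := coefficient_bounded.
have [B B0 AB] := generator_smoothing structural T0 (lexx 0) ler01.
have [Ba Ba0 ABa] :=
  generator_smoothing structural T0 (ltW alpha0) (ltW alpha1).
exists (K * (Ba * N) + B * C) => [|u k u0 k0 ukT].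
  by rewrite addr_ge0 ?mulr_ge0.
have uuk : u < u + k by rewrite ltrDl.
have ukT' : u + k <= T by lra.
have uk : u + k - u = k by ring.
have kT : k <= T by lra.
have kkT : k + k <= T by lra.
have uT : u <= T by lra.
have kk0 : 0 < k + k by lra.
set dx := x (u + k) - x u.
set rem := increment u (u + k) - dx *: S k (sigma (y u)).
have remC : `|rem| <= C * k `^ theta.
  by have := IC u (u + k) u0 uuk ukT'; rewrite uk.
have -> : S k (increment u (u + k)) = dx *: S (k + k) (sigma (y u)) + S k rem.
  rewrite /rem (semigroupB semigroupS (increment u (u + k)) _ (ltW k0)).
  rewrite (semigroupZ semigroupS) ?(ltW k0)//.
  rewrite (@semigroupD _ _ _ semigroupS k k) ?(ltW k0)//.
  by rewrite [RHS]addrC subrK.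
have [[_ _ Al] _] := generatesS.
rewrite (Al _ _ _ (domainS _ kk0) (domainS _ k0)).
rewrite (le_trans (ler_normD _ _))// mulrDl lerD//.
  rewrite normrZ [leRHS](_ : _ =
    (K * k `^ eta) * (Ba * k `^ (alpha - 1) * N)); last first.
    have -> : theta - 1 = eta + (alpha - 1) by rewrite /theta; ring.
    by rewrite powRDpos//; ring.
  apply: ler_pM => //.
    by have := xK u (u + k) u0 uuk ukT'; rewrite uk.
  have [Xs_ sle] := sN u u0 uT.
  apply: le_trans (ABa _ _ kk0 kkT Xs_) _.
  apply: ler_pM => //; rewrite ?mulr_ge0 ?powR_ge0 ?bs_norm_ge0//.
  by rewrite ler_wpM2l// powR_ge_exp// ?subr_le0 ?(ltW alpha1)// lerDl ltW.
apply: le_trans (AB _ rem k0 kT (scale0_setT structural rem)) _.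
rewrite (scale0_norm (structural_scale structural)) sub0r -mulrA -mulrA.
rewrite ler_wpM2l//; apply: le_trans (ler_wpM2l (powR_ge0 _ _) remC) _.
by rewrite mulrCA ler_wpM2l// (addrC theta) (powRDpos (-1) theta k0).
Qed.

(** The increment over [[u, v]] is the sum of the increments over the intervals
    [[v - h / 2 ^ n, v - h / 2 ^ n.+1]], [h = v - u], each transported to [v];
    closedness of [A] sums their images. *)
Lemma generator_increment : exists2 C, 0 <= C & forall u v, 0 <= u -> u < v ->
  v <= T -> D (increment u v) /\
            `|A (increment u v)| <= C * (v - u) `^ (theta - 1).
Proof.
have [C C0 AC] := generator_increment_step.
have [C' C'0 IC] := increment_vanishes.
have th1 : 0 < theta - 1 by rewrite subr_gt0.
pose q : R := 2^-1 `^ (theta - 1).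
have q0 : 0 <= q by exact: powR_ge0.
have q1 : q < 1 by exact: half_powR_lt1.
have q1' : 0 < 1 - q by rewrite subr_gt0.
exists (C / (1 - q)) => [|u v u0 uv vT]; first by rewrite divr_ge0 ?(ltW q1').
set h := v - u; have h0 : 0 < h by rewrite subr_gt0.
pose m (n : nat) := v - h / 2 ^+ n.
pose z n := increment u v - increment (m n) v.
have hn n : 0 < h / 2 ^+ n by rewrite divr_gt0// exprn_gt0.
have hS n : h / 2 ^+ n = h / 2 ^+ n.+1 + h / 2 ^+ n.+1.
  by rewrite exprS; field; rewrite expf_neq0.
have hle n : h / 2 ^+ n <= h.
  by rewrite ler_pdivrMr ?exprn_gt0// ler_peMr ?(ltW h0)// exprn_ege1// ler1n.
have mu n : u <= m n by rewrite /m; have := hle n; rewrite /h; lra.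
have m0 n : 0 <= m n := le_trans u0 (mu n).
have mv n : m n < v by rewrite /m; have := hn n; lra.
have mS n : m n.+1 = m n + h / 2 ^+ n.+1 by rewrite /m (hS n); ring.
have zS n : z n.+1 - z n =
    S (h / 2 ^+ n.+1) (increment (m n) (m n + h / 2 ^+ n.+1)).
  have mm : m n <= m n.+1 by rewrite mS lerDl ltW.
  rewrite /z (@increment_split (m n) (m n.+1))// ?ltW// -mS.
  have -> : v - m n.+1 = h / 2 ^+ n.+1 by rewrite /m; ring.
  have telescope_step (a b c : X) : a - b - (a - (c + b)) = c.
    by rewrite opprB [LHS]addrC subrKA addrK.
  exact: telescope_step.
have z0 : z 0%N = 0 by rewrite /z /m expr0 divr1 subKr subrr.
have Dz n : D (z n).
  elim: n => [|n ih]; first by rewrite z0; case: generatesS => -[].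
  rewrite -(subrK (z n) (z n.+1)) zS.
  exact: (generatorD generatesS (domainS _ (hn _)) ih).1.
have A0 : A (z 0%N) = 0.
  by have := (generatorB generatesS (Dz 0%N) (Dz 0%N)).2; rewrite !subrr z0.
have AzS n : `|A (z n.+1) - A (z n)| <= C * h `^ (theta - 1) * q ^+ n.
  rewrite -(generatorB generatesS (Dz _) (Dz _)).2 zS.
  apply: le_trans (AC _ _ (m0 n) (hn _) _) _.
    by rewrite -mS /m subrK.
  rewrite powR_halfn ?(ltW h0)// -mulrA ler_wpM2l// mulrC.
  by rewrite ler_wpM2l ?powR_ge0// exprS -/q ler_piMl ?exprn_ge0 ?(ltW q1).
have [l Azl ll] := geometric_limit q0 q1 A0 AzS.
have zI : z n @[n --> \oo] --> increment u v.
  rewrite -[X in _ --> X]subr0; apply: cvgB; first exact: cvg_cst.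
  apply/norm_cvg0P.
  have geo : C' * h `^ eta * (2^-1 `^ eta) ^+ n @[n --> \oo] --> (0 : R).
    have := @cvg_geometric R (C' * h `^ eta) (2^-1 `^ eta).
    by rewrite ger0_norm ?powR_ge0// => /(_ (half_powR_lt1 eta0)).
  apply: squeeze_cvgr (cvg_cst (0 : R)) geo; apply: nearW => n.
  rewrite normr_ge0 /=; apply: le_trans (IC _ _ (m0 n) (mv n) vT) _.
  have -> : v - m n = h / 2 ^+ n by rewrite /m; ring.
  by rewrite powR_halfn ?(ltW h0)// mulrA mulrAC.
have [DI AI] := generator_closed semigroupS generatesS boundedS Dz zI Azl.
by rewrite AI; split => //; rewrite mulrAC.
Qed.

Lemma generator_solutionE u r : 0 <= u -> u < r -> r <= T ->
  D (y r) /\ A (y r) = A (S (r - u) (y u)) + A (increment u r).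
Proof.
have [C C0 AC] := generator_increment => u0 ur rT.
have -> : y r = S (r - u) (y u) + increment u r.
  by rewrite /increment addrC subrK.
apply: (generatorD generatesS); first by apply: domainS; rewrite subr_gt0.
exact: (AC _ _ u0 ur rT).1.
Qed.

(** At rate [u `^ (alpha - 1)], the orbit of the initial value dominates. *)
Lemma generator_solution_bound : exists2 C, 0 <= C & forall u, 0 < u ->
  u <= T -> `|A (y u)| <= C * u `^ (alpha - 1).
Proof.
have [C C0 AC] := generator_increment; have [N N0 yN] := solution_bounded.
have [B B0 AB] := generator_smoothing structural T0 (ltW alpha0) (ltW alpha1).
exists (B * N + C * T `^ eta) => [|u u0 uT].
  by rewrite addr_ge0 ?mulr_ge0 ?powR_ge0.
rewrite (generator_solutionE (lexx 0) u0 uT).2 subr0.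
rewrite (le_trans (ler_normD _ _))// mulrDl lerD//.
  have [Xy yle] := yN 0 (lexx 0) (ltW T0).
  apply: le_trans (AB _ _ u0 uT Xy) _.
  by rewrite mulrAC ler_wpM2r ?powR_ge0// ler_wpM2l.
apply: le_trans (AC _ _ (lexx 0) u0 uT).2 _; rewrite subr0.
have -> : theta - 1 = eta + (alpha - 1) by rewrite /theta; ring.
rewrite powRDpos// mulrA ler_wpM2r ?powR_ge0// ler_wpM2l//.
by rewrite powR_le_exp// ltW.
Qed.

Lemma solution_holder : exists2 C, 0 <= C & forall u v, 0 <= u -> u < v ->
  v <= T -> `|y v - y u| <= C * (v - u) `^ alpha.
Proof.
have [N N0 yN] := solution_bounded; have [_ [[Xd _] [K dK]]] := y_regular.
have [c c0 Xc] := scale_embeddingX structural (ltW alpha0) alpha2.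
have [E E0 SE] := semigroup_approx_id structural T0 alpha0 (ltW alpha1).
exists (c * `|K| + E * N) => [|u v u0 uv vT].
  by rewrite addr_ge0 ?mulr_ge0.
have vu : 0 < v - u by rewrite subr_gt0.
have uT : u <= T by rewrite (le_trans (ltW uv)).
have vuT : v - u <= T by rewrite (le_trans _ vT)// gerBl.
rewrite -(subrK (S (v - u) (y u) - y u) (y v - y u)).
rewrite (le_trans (ler_normD _ _))// mulrDl lerD//.
  have tri : triangle 0 T (u, v) by [].
  have := dK _ tri; rewrite /hat_delta1 /= => dle.
  have /Xc := Xd _ tri; rewrite /hat_delta1 /= => /le_trans; apply.
  rewrite -mulrA ler_wpM2l// (le_trans dle)//.
  by rewrite ler_wpM2r ?powR_ge0 ?ler_norm.
have [Xy yle] := yN u u0 uT.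
apply: le_trans (SE _ _ vu vuT Xy) _.
by rewrite mulrAC ler_wpM2r ?powR_ge0// ler_wpM2l.
Qed.

(** Near [r0 > 0], the orbit issued from a slightly earlier time [r0 - k] is
    smooth, and what [A] adds along the increment is small with [k]. *)
Lemma generator_solution_continuous r0 e : 0 < r0 -> r0 <= T -> 0 < e ->
  exists2 d, 0 < d & forall r, 0 < r -> r <= T -> `|r - r0| < d ->
    `|A (y r) - A (y r0)| <= e.
Proof.
move=> r00 r0T e0; have [C C0 AC] := generator_increment.
have th1 : 0 < theta - 1 by rewrite subr_gt0.
have [k' k'0 kP] := powR_small C0 th1 (ltac:(by rewrite divr_gt0) : 0 < e / 4).
have [k k0 [kr0 kC]] : exists2 k, 0 < k &
    k <= r0 /\ C * (2 * k) `^ (theta - 1) <= e / 4.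
  exists (Num.min r0 (k' / 2)); first by rewrite lt_min r00 divr_gt0.
  rewrite ge_min lexx; split => //; apply: kP.
    by rewrite mulr_ge0// le_min !ltW ?divr_gt0.
  by rewrite mulrC -ler_pdivlMr// ge_min lexx orbT.
pose u := r0 - k; have u0 : 0 <= u by rewrite subr_ge0.
have r0u : 0 < r0 - u by rewrite /u; lra.
have := generator_orbit_continuous semigroupS generatesS domainS (z := y u) r0u.
have e2 : 0 < e / 2 by rewrite divr_gt0.
move=> /cvgrPdist_le/(_ _ e2)[d /= d0 dP].
exists (Num.min d k); first by rewrite lt_min d0.
move=> r rpos rT; rewrite lt_min => /andP[rd].
rewrite ltr_distl => /andP[rk rk'].
have ur0 : u < r0 by rewrite /u; lra.
have ur : u < r by rewrite /u; lra.
rewrite (generator_solutionE u0 ur rT).2 (generator_solutionE u0 ur0 r0T).2.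
have Abound t : u < t -> t <= T -> t - u <= 2 * k ->
    `|A (increment u t)| <= e / 4.
  move=> ut tT tk; apply: le_trans (AC _ _ u0 ut tT).2 _; apply: le_trans kC.
  by rewrite ler_wpM2l// powR_le_exp ?(ltW th1)// subr_ge0 ltW.
rewrite (opprD (A (S (r0 - u) (y u)))) addrACA (le_trans (ler_normD _ _))//.
rewrite (_ : e = e / 2 + (e / 4 + e / 4)); last by field.
apply: lerD.
  rewrite distrC; apply: dP; rewrite /= distrC.
  by rewrite (_ : r - u - (r0 - u) = r - r0)//; ring.
apply: le_trans (ler_normB _ _) _; apply: lerD.
  by apply: Abound => //; rewrite /u; lra.
by apply: Abound => //; rewrite /u; lra.
Qed.

End mild_solutions.

(** * Integrals with a singularity at the origin *)

Section singular_integrals.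
Context {R : realType}.
Notation mu := (@lebesgue_measure R).
Implicit Types (T alpha : R).

Lemma powR_within_continuous a b (e : R) : 0 < a ->
  {within `[a, b], continuous (@powR R ^~ e)}.
Proof.
move=> a0; apply: continuous_in_subspaceT => r; rewrite inE/= in_itv/=.
move=> /andP[ar _]; have r0 := lt_le_trans a0 ar.
apply: differentiable_continuous; apply/derivable1_diffP.
by have [] := is_derive1_powR e r0.
Qed.

Lemma integral_powR a b alpha : 0 < a -> a < b -> 0 < alpha ->
  (\int[mu]_(r in `[a, b]) (r `^ (alpha - 1))%:E =
   (b `^ alpha / alpha - a `^ alpha / alpha)%:E)%E.
Proof.
move=> a0 ab alpha0.
have dG (r : R) : 0 < r ->
    is_derive r 1 (fun r => alpha^-1 * r `^ alpha) (r `^ (alpha - 1)).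
  move=> r0; have := is_deriveZ alpha^-1 (is_derive1_powR alpha r0).
  by rewrite /GRing.scale /= mulrA mulVf ?gt_eqF// mul1r.
rewrite (@continuous_FTC2 _ _ (fun r => alpha^-1 * r `^ alpha))//.
- by rewrite -EFinB ![_^-1 * _]mulrC.
- exact: powR_within_continuous.
- have Gc (r : R) : 0 < r ->
      {for r, continuous (fun r => alpha^-1 * r `^ alpha)}.
    move=> r0; apply: differentiable_continuous; apply/derivable1_diffP.
    by have [] := dG r r0.
  split.
  + move=> r; rewrite in_itv/= => /andP[ar _].
    by have [] := dG r (lt_trans a0 ar).
  + by apply: cvg_at_right_filter; exact: Gc.
  + by apply: cvg_at_left_filter; exact/Gc/(lt_trans a0).
- move=> r; rewrite in_itv/= => /andP[ar _].
  by rewrite derive1E; have [_] := dG r (lt_trans a0 ar).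
Qed.

(** By monotone convergence on the intervals [[T / (n + 2), T]]. *)
Lemma integrable_powR T alpha : 0 < T -> 0 < alpha ->
  mu.-integrable `]0, T] (fun r => (r `^ (alpha - 1))%:E).
Proof.
move=> T0 alpha0.
have mp (B : set R) : measurable_fun B (EFin \o (@powR R ^~ (alpha - 1))).
  by apply/measurable_EFinP; apply: measurable_funTS; exact: measurable_powR.
apply/integrableP; split; first exact: mp.
under eq_integral do rewrite gee0_abs ?lee_fin ?powR_ge0//.
(* The offset 2 keeps the intervals nondegenerate. *)
pose F (n : nat) : set R := `[T / n.+2%:R, T]%classic.
have FU : `]0, T]%classic = \bigcup_n F n.
  apply/seteqP; split => r /=; rewrite ?in_itv/=.
    move=> /andP[r0 rT].
    have [n nr] : exists n : nat, T / r <= n%:R.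
      by exists (Num.truncn (T / r)).+1; apply/ltW/truncnS_gt.
    exists n => //; rewrite /F /= in_itv/= rT andbT ler_pdivrMr// mulrC.
    rewrite -ler_pdivrMr// (le_trans nr)// ler_nat.
    by rewrite -addn2 leq_addr.
  move=> [n _]; rewrite /F /= in_itv/= => /andP[nr ->]; rewrite andbT.
  by rewrite (lt_le_trans _ nr)// divr_gt0.
have Fint : (\int[mu]_(r in F n) (r `^ (alpha - 1))%:E)%E @[n --> \oo] -->
    (\int[mu]_(r in \bigcup_n F n) (r `^ (alpha - 1))%:E)%E.
  apply: ge0_nondecreasing_set_cvg_integral.
  - apply/nondecreasing_seqP => n; rewrite subsetEset => r /=.
    rewrite /F /= !in_itv/= => /andP[nr ->]; rewrite andbT.
    rewrite (le_trans _ nr)// ler_wpM2l ?(ltW T0)// lef_pV2 ?posrE ?ltr0n//.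
    by rewrite ler_nat.
  - by move=> n; exact: measurable_itv.
  - by move=> n; exact: mp.
  - by move=> n r _; rewrite lee_fin powR_ge0.
rewrite FU -(cvg_lim _ Fint)//.
apply: (@le_lt_trans _ _ (T `^ alpha / alpha)%:E); last exact: ltry.
apply: lime_le; first by apply/cvg_ex; eexists; exact: Fint.
apply: nearW => n; rewrite integral_powR//.
- by rewrite lee_fin gerBl divr_ge0 ?powR_ge0 ?ltW.
- by rewrite divr_gt0.
- by rewrite ltr_pdivrMr ?ltr0n// ltr_pMr// ltr1n.
Qed.

Section antiderivative.
Variables (T alpha C : R) (k : R -> R).
Hypotheses (T0 : 0 < T) (alpha0 : 0 < alpha).
Hypothesis k_bound : forall r, 0 < r -> r <= T ->
  `|k r| <= C * r `^ (alpha - 1).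
Hypothesis k_continuous : forall r0 e, 0 < r0 -> r0 <= T -> 0 < e ->
  exists2 d, 0 < d & forall r, 0 < r -> r <= T -> `|r - r0| < d ->
    `|k r - k r0| <= e.

Let k_measurable : measurable_fun `]0, T]%classic k.
Proof.
apply: subspace_continuous_measurable_fun; first exact: measurable_itv.
apply/subspace_continuousP => r0 /=; rewrite in_itv/= => /andP[r00 r0T].
apply/cvgrPdist_le => e e0; have [d d0 H] := k_continuous r00 r0T e0.
rewrite near_withinE; exists d => //= r rd; rewrite in_itv/= => /andP[r1 r2].
by rewrite distrC; apply: H; rewrite // distrC.
Qed.

Lemma integrable_singular : mu.-integrable `]0, T] (EFin \o k).
Proof.
have Cint : mu.-integrable `]0, T] (fun r => C%:E * (r `^ (alpha - 1))%:E)%E.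
  by apply: integrableZl => //; exact: integrable_powR.
apply: le_integrable Cint => //; first exact/measurable_EFinP.
move=> r /=; rewrite in_itv/= => /andP[r0 rT].
by rewrite lee_fin (le_trans (k_bound r0 rT))// ler_norm.
Qed.

Let integrable_closed : mu.-integrable `[0, T] (EFin \o k).
Proof.
have := integrable_singular => /integrableP[mk ik].
have mk' : measurable_fun `[0, T]%classic (EFin \o k).
  have -> : `[0, T]%classic = [set 0] `|` `]0, T]%classic.
    by rewrite setU1itv ?bnd_simp ?(ltW T0).
  apply/measurable_funU => //; split => //; exact: measurable_fun_set1.
apply/integrableP; split => //.
by rewrite -integral_itv_obnd_cbnd//; exact: measurableT_comp.
Qed.

Definition antiderivative (v : R) : R := \int[mu]_(r in `[0, v]) k r.

Lemma antiderivative_derive r : 0 < r -> r < T ->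
  is_derive r 1 antiderivative (k r).
Proof.
move=> r0 rT; have kc : {for r, continuous k}.
  apply/cvgrPdist_le => e e0; have [d d0 H] := k_continuous r0 (ltW rT) e0.
  near=> t; rewrite distrC; apply: H; near: t.
  - exact: lt_nbhsr.
  - by apply: filterS (lt_nbhsl rT) => t' /ltW.
  - by exists d => // t' /=; rewrite distrC.
have [dF F'] := continuous_FTC1_closed rT integrable_closed r0 kc.
by split; [exact: dF|rewrite -derive1E; exact: F'].
Unshelve. all: by end_near. Qed.

Lemma antiderivative_continuous : {within `[0, T], continuous antiderivative}.
Proof.
exact: (parameterized_integral_continuous (ltW T0) integrable_closed).
Qed.

Lemma antiderivativeB s t : 0 <= s -> s <= t -> t <= T ->
  mu.-integrable `]s, t] (EFin \o k) /\
  \int[mu]_(r in `]s, t]) k r = antiderivative t - antiderivative s.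
Proof.
move=> s0 st tT; have int0t : mu.-integrable `[0, t] (EFin \o k).
  apply: integrableS integrable_closed => //.
  by apply: subset_itvl; rewrite bnd_simp.
split.
  by apply: integrableS int0t => //; apply: subset_itvr; rewrite bnd_simp.
by rewrite /antiderivative Rintegral_itvB// bnd_simp.
Qed.

End antiderivative.
End singular_integrals.

(** * Mean value inequalities *)

Section mean_value.
Context {R : realType}.

Lemma le_increment (H G h g : R -> R) (u v : R) : u < v ->
  (forall r : R, u < r -> r < v -> is_derive r 1 H (h r)) ->
  (forall r : R, u < r -> r < v -> is_derive r 1 G (g r)) ->
  (forall r, u < r -> r < v -> `|h r| <= g r) ->
  {within `[u, v], continuous H} -> {within `[u, v], continuous G} ->
  `|H v - H u| <= G v - G u.
Proof.
move=> uv dH dG hg cH cG; have uv0 : 0 <= v - u by rewrite subr_ge0 ltW.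
rewrite ler_norml; apply/andP; split.
  have [r||c] := @MVT R (G + H) (fun r => g r + h r) u v uv.
  - rewrite in_itv/= => /andP[ur rv].
    by apply: is_deriveD; [exact: dG|exact: dH].
  - exact: within_continuousD.
  rewrite in_itv/= => /andP[uc cv] E.
  have := hg c uc cv; rewrite ler_norml => /andP[hc _].
  have : G v + H v - (G u + H u) = (g c + h c) * (v - u) by exact: E.
  have : 0 <= (g c + h c) * (v - u) by rewrite mulr_ge0//; lra.
  by move=> + E'; rewrite -E'; lra.
have [r||c] := @MVT R (G - H) (fun r => g r - h r) u v uv.
- rewrite in_itv/= => /andP[ur rv].
  by apply: is_deriveB; [exact: dG|exact: dH].
- exact: within_continuousB.
rewrite in_itv/= => /andP[uc cv] E.
have := hg c uc cv; rewrite ler_norml => /andP[_ hc].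
have : G v - H v - (G u - H u) = (g c - h c) * (v - u) by exact: E.
have : 0 <= (g c - h c) * (v - u) by rewrite mulr_ge0//; lra.
by move=> + E'; rewrite -E'; lra.
Qed.

Lemma powR_continuous_within a b (e : R) : 0 <= a -> 0 < e ->
  {within `[a, b], continuous (@powR R ^~ e)}.
Proof.
move=> a0 e0; apply/subspace_continuousP => r /=.
rewrite in_itv/= => /andP[ar rb].
have := le_trans a0 ar; rewrite le_eqVlt => /predU1P[r0|r0].
  rewrite -r0 /from_subspace /= powR0 ?gt_eqF//.
  have /cvgrPdist_le H := powR_cvg0 e0; apply/cvgrPdist_le => d d0.
  have [k /= k0 kP] := H d d0; rewrite near_withinE; exists k => //= t tk.
  rewrite in_itv/= => /andP[at_ _]; have := le_trans a0 at_.
  rewrite le_eqVlt => /predU1P[<-|t0]; last exact: kP.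
  by rewrite powR0 ?gt_eqF// subrr normr0 ltW.
apply: cvg_within_filter; apply: differentiable_continuous.
by apply/derivable1_diffP; have [] := is_derive1_powR e r0.
Qed.

End mean_value.

(** * The chain rule along the solution *)

Section chain_rule.
Context {R : realType} {X : completeNormedModType R}.
Variables (D : set X) (A : X -> X) (S : R -> X -> X).
Variables (Xs : R -> banach_subspace X) (T eta alpha gamma : R) (x : R -> R).
Variables (sigma : X -> X) (psi : X) (F Ft : R -> X -> R) (y : R -> X).
Hypothesis T0 : 0 < T.
Hypothesis structural : structural_assumptions D A S Xs.
Hypothesis eta0 : 0 < eta.
Hypothesis x_holder : holder_on 0 T eta x.
Hypotheses (alpha0 : 0 < alpha) (alpha1 : alpha < 1).
Hypothesis young : 1 < alpha + eta.
Hypothesis sigmaP : sigma_assumptions Xs alpha sigma.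
Hypothesis F_C1 : C1_with T F Ft.
Hypothesis F_holder_t : diff_x_holder_t T alpha F.
Hypotheses (gamma0 : 0 < gamma) (gamma1 : gamma < 1).
Hypothesis young_chain : 1 < eta + alpha * gamma.
Hypothesis F_holder_x : diff_x_holder_x T gamma F.
Hypothesis mild : mild_solution S Xs sigma x psi T alpha y.
Hypothesis y_regular : hat_C S (Xs alpha) 0 T alpha y.

Let alpha2 : alpha < 2. Proof. by rewrite (lt_trans alpha1)// ltr1n. Qed.
Let ag0 : 0 < alpha * gamma. Proof. exact: mulr_gt0. Qed.
Let semigroupS := structural_semigroup structural.
Let generatesS := structural_generator structural.
Let domainS := semigroup_in_domain structural.
Let y_holder := solution_holder T0 structural alpha0 alpha1 y_regular.
Let y_generatorE := generator_solutionE T0 structural eta0 x_holder alpha0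
  alpha1 young sigmaP mild y_regular.

Lemma diff_x_linear t z : linear (diff_x F t z : X -> R^o).
Proof. by move=> c u v; rewrite /diff_x linearP. Qed.

Lemma diff_xB t z u v : diff_x F t z (u - v) = diff_x F t z u - diff_x F t z v.
Proof. by rewrite /diff_x linearB. Qed.

Lemma diff_xD t z u v : diff_x F t z (u + v) = diff_x F t z u + diff_x F t z v.
Proof. by rewrite /diff_x linearD. Qed.

Lemma diff_xZ t z c u : diff_x F t z (c *: u) = c * diff_x F t z u.
Proof. by rewrite /diff_x linearZ. Qed.

Lemma diff_x_continuous t z : 0 <= t -> t <= T ->
  continuous (diff_x F t z : X -> R^o).
Proof. by move=> t0 tT; apply: diff_continuous; exact: (C1_dx F_C1). Qed.

Lemma diff_x_bounded rho : 0 <= rho -> exists2 C, 0 <= C & forall t z w,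
  0 <= t -> t <= T -> `|z| <= rho -> `|diff_x F t z w| <= C * `|w|.
Proof.
move=> rho0; have [K1 H1] := F_holder_t rho; have [K2 H2] := F_holder_x rho.
have [k k0 kP] :=
  linear_lipschitz (diff_x_continuous (z := 0) (lexx 0) (ltW T0)).
exists (k + `|K1| * T `^ alpha + `|K2| * rho `^ gamma) => [|t z w t0 tT zr].
  by rewrite !addr_ge0 ?mulr_ge0 ?powR_ge0 ?(ltW k0).
rewrite [diff_x F t z w](_ : _ = diff_x F 0 0 w
  + (diff_x F t 0 w - diff_x F 0 0 w)
  + (diff_x F t z w - diff_x F t 0 w)); last first.
  by rewrite [in RHS](addrC (diff_x F 0 0 w)) subrK [RHS]addrC subrK.
rewrite !mulrDl (le_trans (ler_normD _ _))// lerD//; last first.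
  have z00 : `|0 : X| <= rho by rewrite normr0.
  apply: le_trans (H2 t z 0 t0 tT zr z00 w) _; rewrite subr0.
  rewrite ler_wpM2r// (le_trans (ler_wpM2r (powR_ge0 _ _) (ler_norm K2)))//.
  by rewrite ler_wpM2l// powR_le_exp// ltW.
rewrite (le_trans (ler_normD _ _))// lerD//; first exact: kP.
have z00 : `|0 : X| <= rho by rewrite normr0.
apply: le_trans (H1 0 0 t z00 (lexx 0) (ltW T0) t0 tT w) _; rewrite subr0.
rewrite ler_wpM2r// (le_trans (ler_wpM2r (powR_ge0 _ _) (ler_norm K1)))//.
by rewrite ler_wpM2l// powR_le_exp ?(ltW alpha0)// ger0_norm.
Qed.

Lemma solution_norm_bounded : exists2 N, 0 <= N & forall r, 0 <= r -> r <= T ->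
  `|y r| <= N.
Proof.
have [N N0 yN] := solution_bounded T0 y_regular.
have [c c0 Xc] := scale_embeddingX structural (ltW alpha0) alpha2.
exists (c * N) => [|r r0 rT]; first exact: mulr_ge0.
have [Xy yle] := yN r r0 rT.
by apply: le_trans (Xc _ Xy) _; rewrite ler_wpM2l.
Qed.

Lemma segment_norm u v theta N : 0 <= theta -> theta <= 1 ->
  `|y u| <= N -> `|y v| <= N -> `|y u + theta *: (y v - y u)| <= 3 * N.
Proof.
move=> th0 th1 yu yv; rewrite (le_trans (ler_normD _ _))//.
have : `|theta *: (y v - y u)| <= N + N.
  rewrite normrZ ger0_norm// (le_trans (ler_piMl _ th1))//.
  by rewrite (le_trans (ler_normB _ _))// lerD.
by move=> H; apply: le_trans (lerD yu H) _; rewrite le_eqVlt; apply/orP; left;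
  apply/eqP; ring.
Qed.

(** The exponent comes from the [gamma]-Hoelder dependence on the state, as [y]
    is [alpha]-Hoelder continuous. Points of the segment [[y u, y v]] are
    included, since the mean value theorem evaluates [F_x] at one of them. *)
Lemma diff_x_variation : exists2 C, 0 <= C & forall u v r theta w,
  0 <= u -> u < v -> v <= T -> u <= r -> r <= v -> 0 <= theta -> theta <= 1 ->
  `|diff_x F u (y u + theta *: (y v - y u)) w - diff_x F r (y r) w|
    <= C * (v - u) `^ (alpha * gamma) * `|w|.
Proof.
have [N N0 yN] := solution_norm_bounded; have [H H0 yH] := y_holder.
have [K1 F1] := F_holder_t (3 * N); have [K2 F2] := F_holder_x (3 * N).
exists (`|K1| * T `^ (alpha - alpha * gamma) + `|K2| * (2 * H) `^ gamma).
  by rewrite addr_ge0 ?mulr_ge0 ?powR_ge0.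
move=> u v r theta w u0 uv vT ur rv th0 th1.
have v0 : 0 <= v by rewrite (le_trans u0)// ltW.
have uT : u <= T by rewrite (le_trans (ltW uv)).
have r0 : 0 <= r := le_trans u0 ur; have rT : r <= T := le_trans rv vT.
have vu : 0 < v - u by rewrite subr_gt0.
have vuT : v - u <= T by rewrite (le_trans _ vT)// gerBl.
set xi := y u + _.
have xiN : `|xi| <= 3 * N by apply: segment_norm => //; exact: yN.
have yrN : `|y r| <= 3 * N.
  by rewrite (le_trans (yN r r0 rT))// ler_peMl// ler1n.
rewrite -(subrKA (diff_x F r xi w)) (le_trans (ler_normD _ _))//.
rewrite 2!mulrDl lerD//.
  apply: le_trans (F1 xi r u xiN r0 rT u0 uT w) _; rewrite ler_wpM2r//.
  apply: le_trans (ler_wpM2r (powR_ge0 _ _) (ler_norm K1)) _.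
  rewrite -mulrA ler_wpM2l//.
  apply: (@le_trans _ _ ((v - u) `^ alpha)).
    by rewrite powR_le_exp ?(ltW alpha0)// distrC ger0_norm ?subr_ge0// lerD2r.
  have -> : (v - u) `^ alpha =
      (v - u) `^ (alpha - alpha * gamma) * (v - u) `^ (alpha * gamma).
    by rewrite -powRDpos// subrK.
  rewrite ler_wpM2r ?powR_ge0//.
  by rewrite powR_le_exp ?(ltW vu)// subr_ge0 ler_piMr// ltW.
apply: le_trans (F2 r xi (y r) r0 rT xiN yrN w) _; rewrite ler_wpM2r//.
apply: le_trans (ler_wpM2r (powR_ge0 _ _) (ler_norm K2)) _.
rewrite -mulrA ler_wpM2l// powRrM -powRM ?mulr_ge0 ?powR_ge0//.
rewrite powR_le_exp ?(ltW gamma0)//.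
have yuv := yH u v u0 uv vT.
have yur : `|y u - y r| <= H * (v - u) `^ alpha.
  move: ur; rewrite le_eqVlt => /predU1P[->|ur].
    by rewrite subrr normr0 mulr_ge0 ?powR_ge0.
  rewrite distrC (le_trans (yH u r u0 ur rT))// ler_wpM2l// powR_le_exp//.
  - exact: ltW.
  - by rewrite subr_ge0 ltW.
  - by rewrite lerD2r.
rewrite /xi addrAC (le_trans (ler_normD _ _))//.
rewrite -mulrA mulr2n mulrDl !mul1r lerD//.
rewrite normrZ ger0_norm// (le_trans (ler_piMl _ th1))//.
Qed.

Lemma solution_holder_sym : exists2 C, 0 <= C & forall u v,
  0 <= u -> u <= T -> 0 <= v -> v <= T -> `|y v - y u| <= C * `|v - u| `^ alpha.
Proof.
have [H H0 yH] := y_holder; exists H => // u v u0 uT v0 vT.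
have [uv|vu|->] := ltgtP u v.
- by rewrite gtr0_norm ?subr_gt0//; exact: yH.
- by rewrite distrC (distrC v) gtr0_norm ?subr_gt0//; exact: yH.
- by rewrite subrr normr0 mulr_ge0 ?powR_ge0.
Qed.

Lemma time_derivative_near r0 e : 0 <= r0 -> r0 <= T -> 0 < e ->
  exists2 d, 0 < d & forall r v, 0 <= r -> r <= T -> 0 <= v -> v <= T ->
    `|r - r0| < d -> `|v - r0| < d -> `|Ft r (y v) - Ft r0 (y r0)| <= e.
Proof.
move=> r00 r0T e0; have [H H0 yH] := solution_holder_sym.
have /subspace_continuousP/(_ (r0, y r0)) := C1_dt_continuous F_C1.
rewrite /strip /= r00 r0T => /(_ isT)/cvgrPdist_le/(_ e e0).
rewrite near_withinE => /nbhs_ballP[k /= k0 kP].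
have k2 : 0 < k / 2 by rewrite divr_gt0.
have [d d0 dP] := powR_small H0 alpha0 k2.
exists (Num.min d k); first by rewrite lt_min d0.
move=> r v rp rT v0 vT; rewrite !lt_min => /andP[_ rk] /andP[vd _].
have := kP (r, y v); rewrite /= rp rT => /(_ _ isT); rewrite distrC; apply.
split; first by rewrite -ball_normE /= distrC.
rewrite -ball_normE /= distrC (le_lt_trans (yH _ _ r00 r0T v0 vT))//.
rewrite (le_lt_trans (dP _ _ (ltW vd)))//.
by rewrite ltr_pdivrMr// ltr_pMr// ltr1n.
Qed.

(** Uniform continuity, by compactness of [[0, T]]. *)
Lemma time_derivative_uniform e : 0 < e -> exists2 d, 0 < d & forall r v,
  0 <= r -> r <= T -> 0 <= v -> v <= T -> `|v - r| < d ->
  `|Ft r (y v) - Ft r (y r)| <= e.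
Proof.
move=> e0; have e2 : 0 < e / 2 by rewrite divr_gt0.
pose P (d r : R) := forall v, 0 <= v -> v <= T -> `|v - r| < d ->
  0 <= r -> r <= T -> `|Ft r (y v) - Ft r (y r)| <= e.
have : \forall d \near (0 : R)^'+, `[0, T]%classic `<=` P d.
  apply: ((compact_near_coveringP _).1 (@segment_compact R 0 T)) => r0 /=.
  rewrite in_itv/= => /andP[r00 r0T].
  have [k k0 kP] := time_derivative_near r00 r0T e2.
  have k2 : 0 < k / 2 by rewrite divr_gt0.
  near=> r d => v v0 vT vd rp rT.
  have rk : `|r - r0| < k / 2.
    by near: r; exists (k / 2) => // t /=; rewrite distrC.
  have dk : d <= k / 2 by near: d; exact: nbhs_right_le.
  have rk' : `|r - r0| < k.
    by rewrite (lt_le_trans rk)// ler_pdivrMr// ler_peMr ?(ltW k0)// ler1n.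
  have vk : `|v - r0| < k.
    rewrite -(subrKA r) (le_lt_trans (ler_normD _ _))// (splitr k) ltrD//.
    exact: lt_le_trans dk.
  rewrite -(subrKA (Ft r0 (y r0))) (le_trans (ler_normD _ _))//.
  rewrite (splitr e) lerD//.
    exact: kP.
  by rewrite distrC; exact: kP.
move=> H; have [d [d0 dP]] : exists d : R, 0 < d /\ `[0, T]%classic `<=` P d.
  near (0 : R)^'+ => d; exists d; split; last by near: d.
  by near: d; exact: nbhs_right_gt.
exists d => // r v rp rT v0 vT vd; apply: dP => //=.
by rewrite in_itv/= rp.
Unshelve. all: by end_near. Qed.

Let time_integrand (r : R) := Ft r (y r).

Lemma time_integrand_continuous r0 e : 0 < r0 -> r0 <= T -> 0 < e ->
  exists2 d, 0 < d & forall r, 0 < r -> r <= T -> `|r - r0| < d ->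
    `|time_integrand r - time_integrand r0| <= e.
Proof.
move=> r00 r0T e0; have [d d0 dP] := time_derivative_near (ltW r00) r0T e0.
by exists d => // r rp rT rd; apply: dP => //; exact: ltW.
Qed.

Lemma time_integrand_bounded : exists2 C, 0 <= C & forall r, 0 < r -> r <= T ->
  `|time_integrand r| <= C * r `^ (alpha - 1).
Proof.
have nc : {within `[0, T], continuous (fun r => `|time_integrand r|)}.
  apply/subspace_continuousP => r0 /=; rewrite in_itv/= => /andP[r00 r0T].
  apply: cvg_norm; apply/cvgrPdist_le => e e0.
  have [d d0 dP] := time_derivative_near r00 r0T e0.
  rewrite near_withinE; exists d => //= r; rewrite /= distrC => rd.
  rewrite in_itv/= => /andP[rp rT].
  by rewrite distrC; exact: dP.
have [c _ cmax] := EVT_max (ltW T0) nc.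
exists (`|time_integrand c| * T `^ (1 - alpha)) => [|r r0 rT].
  by rewrite mulr_ge0 ?powR_ge0.
have := cmax r; rewrite in_itv/= (ltW r0) rT => /(_ isT) /le_trans; apply.
have -> : alpha - 1 = - (1 - alpha) by rewrite opprB.
rewrite -mulrA ler_peMr// powRN ler_pdivlMr ?powR_gt0// mul1r.
by rewrite powR_le_exp ?subr_ge0 ?(ltW alpha1) ?(ltW r0).
Qed.

Lemma F_time_derive r z : 0 < r -> r < T ->
  is_derive r 1 (fun t => F t z) (Ft r z).
Proof.
move=> r0 rT; apply/is_derive_quotientP/cvgrPdist_le => e e0.
have /cvgrPdist_le/(_ e e0) := @C1_dt _ _ _ _ _ F_C1 r z (ltW r0) (ltW rT).
rewrite /dnbhs !near_withinE => /nbhs_ballP[k /= k0 kP].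
exists (Num.min k (Num.min r (T - r))).
  by rewrite /= !lt_min k0 r0 subr_gt0.
move=> t /=; rewrite sub0r normrN !lt_min !ltr_norml.
move=> /andP[/andP[tk kt] /andP[/andP[tr _] /andP[_ tT]]] tn0.
have := kP (t + r); rewrite addrK; apply.
- by rewrite -ball_normE /= opprD addrCA subrr addr0 normrN ltr_norml tk.
- by rewrite -subr_eq0 addrK.
- by rewrite in_itv/=; lra.
Qed.

Lemma F_time_continuous z : {within `[0, T], continuous (F ^~ z)}.
Proof.
apply/subspace_continuousP => r /=; rewrite in_itv/= => /andP[r0 rT].
apply/cvgrPdist_le => e e0.
have /cvgrPdist_le/(_ 1 ltr01) := @C1_dt _ _ _ _ _ F_C1 r z r0 rT.
rewrite /dnbhs !near_withinE => /nbhs_ballP[k /= k0 kP].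
pose M := `|Ft r z| + 1; have M0 : 0 < M by rewrite ltr_wpDl.
exists (Num.min k (e / M)); first by rewrite /= lt_min k0 divr_gt0.
move=> t /=; rewrite lt_min => /andP[tk te] tT.
have [->|tr] := eqVneq t r; first by rewrite subrr normr0 ltW.
have := kP t; rewrite -ball_normE => /(_ tk tr tT) q1.
have {}q1 : `|(t - r)^-1 * (F t z - F r z)| <= M.
  rewrite -(subrK (Ft r z) (_^-1 * _)) (le_trans (ler_normD _ _))// addrC.
  by rewrite lerD2l distrC.
have -> : F r z - F t z = - ((t - r) * ((t - r)^-1 * (F t z - F r z))).
  by rewrite mulrA divff ?subr_eq0// mul1r opprB.
rewrite normrN normrM (le_trans (ler_wpM2l _ q1))//.
by rewrite -ler_pdivlMr// distrC ltW.
Qed.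

Let time_antiderivative := antiderivative time_integrand.

(** With the state frozen at [y v], the derivatives of [F ^~ (y v)] and of the
    antiderivative differ on [[u, v]] by an oscillation of [F_t]. *)
Lemma time_increment e : 0 < e -> exists2 d, 0 < d & forall u v,
  0 <= u -> u < v -> v <= T -> v - u < d ->
  `|F v (y v) - F u (y v) - (time_antiderivative v - time_antiderivative u)|
    <= e * (v - u).
Proof.
move=> e0; have [d d0 dP] := time_derivative_uniform e0.
have [C _ bnd] := time_integrand_bounded.
have cnt := time_integrand_continuous.
exists d => // u v u0 uv vT vud.
have v0 : 0 <= v by rewrite (le_trans u0)// ltW.
have sub : `[u, v] `<=` `[0, T]%classic by apply: subset_itv; rewrite bnd_simp.
have := @le_increment R (F ^~ (y v) - time_antiderivative) (fun r => e * r)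
  (fun r => Ft r (y v) - Ft r (y r)) (fun=> e) u v uv.
rewrite -mulrBr.
pose H r := F r (y v) - time_antiderivative r.
have -> : F v (y v) - F u (y v)
    - (time_antiderivative v - time_antiderivative u) = H v - H u.
  by rewrite /H; ring.
apply.
- move=> r ur rv; apply: is_deriveB; first by apply: F_time_derive; lra.
  by apply: (antiderivative_derive T0 alpha0 bnd cnt); lra.
- move=> r ur rv; have := is_deriveZ e (is_derive_id r 1).
  by rewrite /GRing.scale /= mulr1.
- by move=> r ur rv; apply: dP; rewrite ?gtr0_norm ?subr_gt0//; lra.
- apply: within_continuousB; apply: continuous_subspaceW sub _.
    exact: F_time_continuous.
  exact: (antiderivative_continuous T0 alpha0 bnd cnt).
- by apply: continuous_subspaceT => r; apply: cvgMr; exact: cvg_id.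
Qed.

Let space_integrand (r : R) := diff_x F r (y r) (A (y r)).

Let y_generator_bound := generator_solution_bound T0 structural eta0 x_holder
  alpha0 alpha1 young sigmaP mild y_regular.

Lemma space_integrand_bounded : exists2 C, 0 <= C & forall r, 0 < r -> r <= T ->
  `|space_integrand r| <= C * r `^ (alpha - 1).
Proof.
have [N N0 yN] := solution_norm_bounded; have [C C0 FC] := diff_x_bounded N0.
have [B B0 AB] := y_generator_bound.
exists (C * B) => [|r r0 rT]; first exact: mulr_ge0.
apply: le_trans (FC _ _ _ (ltW r0) rT (yN r (ltW r0) rT)) _.
by rewrite -mulrA ler_wpM2l// AB.
Qed.

Lemma diff_x_variation_sym : exists2 C, 0 <= C & forall r r0 w,
  0 <= r -> r <= T -> 0 <= r0 -> r0 <= T ->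
  `|diff_x F r (y r) w - diff_x F r0 (y r0) w|
    <= C * `|r - r0| `^ (alpha * gamma) * `|w|.
Proof.
have [C C0 FC] := diff_x_variation; exists C => // r r0 w rp rT r00 r0T.
have [rr0|rr0|->] := ltgtP r r0.
- have := FC r r0 r0 0 w rp rr0 r0T (ltW rr0) (lexx _) (lexx _) ler01.
  rewrite scale0r addr0 (distrC r).
  by rewrite [X in _ -> _ <= C * X `^ _ * _]gtr0_norm ?subr_gt0.
- have := FC r0 r r 0 w r00 rr0 rT (ltW rr0) (lexx _) (lexx _) ler01.
  rewrite scale0r addr0 distrC.
  by rewrite [X in _ -> _ <= C * X `^ _ * _]gtr0_norm ?subr_gt0.
- by rewrite subrr normr0 !mulr_ge0 ?powR_ge0.
Qed.

Lemma space_integrand_continuous r0 e : 0 < r0 -> r0 <= T -> 0 < e ->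
  exists2 d, 0 < d & forall r, 0 < r -> r <= T -> `|r - r0| < d ->
    `|space_integrand r - space_integrand r0| <= e.
Proof.
move=> r00 r0T e0; have e2 : 0 < e / 2 by rewrite divr_gt0.
have [N N0 yN] := solution_norm_bounded; have [C C0 FC] := diff_x_bounded N0.
have [B B0 FB] := diff_x_variation_sym.
have C1 : 0 < C + 1 by rewrite ltr_wpDl.
have eC : 0 < e / 2 / (C + 1) by rewrite divr_gt0.
have [d1 d10 dA] := generator_solution_continuous T0 structural eta0 x_holder
  alpha0 alpha1 young sigmaP mild y_regular r00 r0T eC.
have BA0 : 0 <= B * `|A (y r0)| by rewrite mulr_ge0.
have [d2 d20 dF] := powR_small BA0 ag0 e2.
exists (Num.min d1 d2); first by rewrite lt_min d10.
move=> r rp rT; rewrite lt_min => /andP[rd1 rd2].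
rewrite /space_integrand -(subrKA (diff_x F r (y r) (A (y r0)))).
rewrite (le_trans (ler_normD _ _))// (splitr e) lerD//.
  rewrite -diff_xB (le_trans (FC _ _ _ (ltW rp) rT (yN r (ltW rp) rT)))//.
  apply: le_trans (ler_wpM2l C0 (dA r rp rT rd1)) _.
  rewrite mulrCA ler_piMr ?(ltW e2)// ler_pdivrMr// mul1r.
  by rewrite lerDl.
apply: le_trans (FB _ _ _ (ltW rp) rT (ltW r00) r0T) _.
by rewrite mulrAC dF// ltW.
Qed.

Let space_antiderivative := antiderivative space_integrand.

Lemma mean_value_space u z w : 0 <= u -> u <= T ->
  exists theta, [/\ 0 <= theta, theta <= 1 &
    F u w - F u z = diff_x F u (z + theta *: (w - z)) (w - z)].
Proof.
move=> u0 uT; pose f (theta : R) := F u (z + theta *: (w - z)).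
have df (theta : R) :
    is_derive theta 1 f (diff_x F u (z + theta *: (w - z)) (w - z)).
  set a := z + theta *: (w - z).
  have da : differentiable (F u : X -> R^o) a by exact: (C1_dx F_C1).
  have := @diff_derivable _ _ _ _ a (w - z) da.
  rewrite /derivable => /cvg_ex[l fl].
  have l_E : diff_x F u a (w - z) = l.
    by rewrite /diff_x -deriveE// /derive; exact: cvg_lim.
  apply/is_derive_quotientP; rewrite l_E; apply: cvg_trans fl.
  apply: near_eq_cvg; apply: nearW => k /=; rewrite /f /a.
  by rewrite scalerDl (addrCA z).
have [|c] := MVT ltr01 (fun theta _ => df theta).
  apply: continuous_subspaceT => theta; apply: differentiable_continuous.
  by apply/derivable1_diffP; have [] := df theta.
rewrite in_itv/= /f scale1r scale0r addr0 subrKC subr0 mulr1 => /andP[c0 c1] E.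
by exists c; split => //; exact: ltW.
Qed.

Lemma orbit_continuous_within z u v : Xs alpha z ->
  {within `[u, v], continuous (fun r => S (r - u) z)}.
Proof.
move=> Xz; apply/subspace_continuousP => r /=; rewrite in_itv/= => /andP[].
rewrite le_eqVlt => /predU1P[<- uv|ur rv].
  have [E E0 SE] := semigroup_approx_id structural ltr01 alpha0 (ltW alpha1).
  rewrite /from_subspace /= subrr (semigroup0 semigroupS).
  apply/cvgrPdist_le => e e0.
  have EN : 0 <= E * bs_norm (Xs alpha) z by rewrite mulr_ge0 ?bs_norm_ge0.
  have [d d0 dP] := powR_small EN alpha0 e0.
  rewrite near_withinE; exists (Num.min d 1).
    by rewrite /= lt_min d0 ltr01.
  move=> t /=; rewrite lt_min => /andP[td t1]; rewrite in_itv/= => /andP[+ _].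
  rewrite le_eqVlt => /predU1P[<-|ut].
    by rewrite subrr (semigroup0 semigroupS) subrr normr0 ltW.
  have tu : 0 < t - u by rewrite subr_gt0.
  rewrite distrC gtr0_norm// in td; rewrite distrC gtr0_norm// in t1.
  rewrite distrC (le_trans (SE _ _ tu (ltW t1) Xz))// mulrAC.
  by rewrite dP// ltW.
apply: cvg_within_filter.
have ru : 0 < r - u by rewrite subr_gt0.
have Sc := semigroup_strongly_continuous semigroupS (z := z) ru.
apply: (cvg_comp (fun r => r - u) (S ^~ z) _ Sc).
by apply: cvgB; [exact: cvg_id|exact: cvg_cst].
Qed.

Lemma orbit_derive_shift z (u r : R) : u < r ->
  is_derive r 1 (fun r => S (r - u) z) (A (S (r - u) z)).
Proof.
rewrite -subr_gt0 => /(orbit_derive semigroupS generatesS domainS z).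
move=> /is_derive_quotientP H; apply/is_derive_quotientP; apply: cvg_trans H.
by apply: near_eq_cvg; apply: nearW => k; rewrite addrA.
Qed.

(** The functional [L = F_x (u, xi)] at the intermediate point is kept fixed:
    applied to the orbit of [y u], it is differentiable off [u], and its
    derivative differs from the integrand by a Hoelder defect and by the
    contribution of the increments of [y]. *)
Lemma orbit_increment : exists2 C, 0 <= C & forall u v theta,
  0 <= u -> u < v -> v <= T -> 0 <= theta -> theta <= 1 ->
  `|diff_x F u (y u + theta *: (y v - y u)) (S (v - u) (y u) - y u)
    - (space_antiderivative v - space_antiderivative u)|
    <= C * ((v - u) `^ (alpha * gamma) * (v `^ alpha - u `^ alpha)
            + (v - u) `^ (alpha + eta)).
Proof.
have [N N0 yN] := solution_norm_bounded.
have N30 : 0 <= 3 * N by rewrite mulr_ge0.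
have [B B0 FB] := diff_x_bounded N30.
have [H H0 FH] := diff_x_variation.
have [C1 C10 yA] := y_generator_bound.
have [C2 C20 IA] := generator_increment T0 structural eta0 x_holder alpha0
  alpha1 young sigmaP mild y_regular.
have [N' N'0 yN'] := solution_bounded T0 y_regular.
have [C _ bnd] := space_integrand_bounded.
have cnt := space_integrand_continuous.
exists (H * C1 / alpha + B * C2) => [|u v theta u0 uv vT th0 th1].
  by rewrite addr_ge0 ?divr_ge0 ?mulr_ge0 ?(ltW alpha0).
have v0 : 0 <= v by rewrite (le_trans u0)// ltW.
have uT : u <= T by rewrite (le_trans (ltW uv)).
have vu : 0 < v - u by rewrite subr_gt0.
have sub : `[u, v] `<=` `[0, T]%classic by apply: subset_itv; rewrite bnd_simp.
set xi := y u + _.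
have xiN : `|xi| <= 3 * N by apply: segment_norm => //; exact: yN.
pose L := diff_x F u xi : X -> R.
(* [a] collects the Hoelder defect of [L], [b] the increments of [y]. *)
pose a := H * C1 / alpha * (v - u) `^ (alpha * gamma).
pose b := B * C2 * (v - u) `^ (alpha + eta - 1).
have a0 : 0 <= a by rewrite !mulr_ge0 ?powR_ge0 ?invr_ge0 ?(ltW alpha0).
have b0 : 0 <= b by rewrite !mulr_ge0 ?powR_ge0.
pose f r : R := L (S (r - u) (y u)) - space_antiderivative r.
pose G r : R := a * r `^ alpha + b * r.
have -> : L (S (v - u) (y u) - y u)
    - (space_antiderivative v - space_antiderivative u) = f v - f u.
  rewrite /f subrr (semigroup0 semigroupS) /L diff_xB; ring.
have -> : (H * C1 / alpha + B * C2) *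
    ((v - u) `^ (alpha * gamma) * (v `^ alpha - u `^ alpha)
     + (v - u) `^ (alpha + eta)) =
    G v - G u + (H * C1 / alpha * (v - u) `^ (alpha + eta)
     + B * C2 * ((v - u) `^ (alpha * gamma) * (v `^ alpha - u `^ alpha))).
  have -> : (v - u) `^ (alpha + eta) = (v - u) `^ (alpha + eta - 1) * (v - u).
    by rewrite mulrC mulr_powRB1 ?(ltW vu)// (lt_trans ltr01 young).
  by rewrite /G /a /b; ring.
apply: (@le_trans _ _ (G v - G u)); last first.
  (* The terms that do not appear in [G] are nonnegative. *)
  have K0 : 0 <= H * C1 / alpha by rewrite divr_ge0 ?mulr_ge0 ?(ltW alpha0).
  have D0 : 0 <= v `^ alpha - u `^ alpha.
    by rewrite subr_ge0 powR_le_exp// ltW.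
  have BC0 : 0 <= B * C2 by exact: mulr_ge0.
  rewrite lerDl; apply: addr_ge0; apply: mulr_ge0 => //; first exact: powR_ge0.
  by apply: mulr_ge0 => //; exact: powR_ge0.
pose h r := L (A (S (r - u) (y u))) - space_integrand r.
pose g r : R := a * (alpha * r `^ (alpha - 1)) + b.
apply: (@le_increment R f G h g u v uv).
- move=> r ur rv; apply: is_deriveB.
    apply: (is_derive_linear (@diff_x_linear u xi)
      (diff_x_continuous (z := xi) u0 uT)).
    exact: orbit_derive_shift.
  by apply: (antiderivative_derive T0 alpha0 bnd cnt); lra.
- move=> r ur rv; apply: is_deriveD.
    by apply: is_deriveZ; apply: is_derive1_powR; lra.
  have := is_deriveZ b (is_derive_id r 1).
  by rewrite /GRing.scale /= mulr1.
- move=> r ur rv; have rT : r <= T by lra.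
  have r0 : 0 < r by lra.
  have [_ Ayr] := y_generatorE u0 ur rT.
  have -> : h r = L (A (y r)) - space_integrand r - L (A (increment S y u r)).
    by rewrite /h Ayr /L diff_xD; ring.
  rewrite (le_trans (ler_normB _ _))// /g lerD//.
    apply: le_trans (FH u v r theta _ u0 uv vT (ltW ur) (ltW rv) th0 th1) _.
    apply: le_trans (ler_wpM2l _ (yA r r0 rT)) _.
      by rewrite mulr_ge0 ?powR_ge0.
    rewrite le_eqVlt /a; apply/orP; left; apply/eqP; field.
    by rewrite gt_eqF.
  apply: le_trans (FB _ _ _ u0 uT xiN) _; rewrite /b -mulrA ler_wpM2l//.
  apply: le_trans (IA u r u0 ur rT).2 _.
  rewrite ler_wpM2l// powR_le_exp ?subr_ge0 ?(ltW young) ?(ltW ur)//.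
  by rewrite lerD2r ltW.
- apply: within_continuousB; last first.
    apply: continuous_subspaceW sub _.
    exact: (antiderivative_continuous T0 alpha0 bnd cnt).
  move=> r; have Sc := @orbit_continuous_within (y u) u v (yN' u u0 uT).1 r.
  have Lc : continuous L := diff_x_continuous (z := xi) u0 uT.
  exact: continuous_comp Sc (Lc _).
- apply: within_continuousD.
    by move=> r; apply: cvgMr; exact: powR_continuous_within.
  by apply: continuous_subspaceT => r; apply: cvgMr; exact: cvg_id.
Qed.

(** The increment of [y] is [(x v - x u) *: sigma (y u)] up to an error of order
    [alpha + eta]. Moving [F_x] from the intermediate point to [y u] costs
    [alpha * gamma] on top of the order [eta] of the driver. *)
Lemma convolution_increment : exists2 C, 0 <= C & forall u v theta,
  0 <= u -> u < v -> v <= T -> 0 <= theta -> theta <= 1 ->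
  `|diff_x F u (y u + theta *: (y v - y u)) (increment S y u v)
    - (x v - x u) * diff_x F u (y u) (sigma (y u))|
    <= C * ((v - u) `^ (alpha + eta) + (v - u) `^ (eta + alpha * gamma)).
Proof.
have [N N0 yN] := solution_norm_bounded.
have N30 : 0 <= 3 * N by rewrite mulr_ge0.
have [B B0 FB] := diff_x_bounded N30.
have [H H0 FH] := diff_x_variation.
have [C2 C20 IC] := increment_estimate0 T0 structural eta0 x_holder alpha0
  alpha1 young sigmaP mild y_regular.
have [K K0 xK] := driver_holder x_holder.
have [M M0 sM] := coefficient_bounded T0 sigmaP y_regular.
have [c c0 Xc] := scale_embeddingX structural (ltW alpha0) alpha2.
exists (B * C2 + K * (H * (c * M))) => [|u v theta u0 uv vT th0 th1].
  by rewrite addr_ge0 ?mulr_ge0.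
have v0 : 0 <= v by rewrite (le_trans u0)// ltW.
have uT : u <= T by rewrite (le_trans (ltW uv)).
have vu : 0 < v - u by rewrite subr_gt0.
set xi := y u + _.
have xiN : `|xi| <= 3 * N by apply: segment_norm => //; exact: yN.
set z := sigma (y u); set dx := x v - x u.
have -> : diff_x F u xi (increment S y u v) - dx * diff_x F u (y u) z =
    diff_x F u xi (increment S y u v - dx *: z)
    + dx * (diff_x F u xi z - diff_x F u (y u) z).
  rewrite (diff_xB u xi (increment S y u v)) diff_xZ mulrBr.
  by rewrite [RHS]subrKA.
rewrite (le_trans (ler_normD _ _))//.
have e1 : `|diff_x F u xi (increment S y u v - dx *: z)|
    <= B * C2 * (v - u) `^ (alpha + eta).
  by rewrite (le_trans (FB _ _ _ u0 uT xiN))// -mulrA ler_wpM2l//; exact: IC.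
have e2 : `|dx * (diff_x F u xi z - diff_x F u (y u) z)|
    <= K * (H * (c * M)) * (v - u) `^ (eta + alpha * gamma).
  have -> : K * (H * (c * M)) * (v - u) `^ (eta + alpha * gamma) =
      K * (v - u) `^ eta * (H * (v - u) `^ (alpha * gamma) * (c * M)).
    by rewrite powRDpos//; ring.
  rewrite normrM ler_pM//; first exact: xK.
  apply: le_trans (FH u v u theta z u0 uv vT (lexx u) (ltW uv) th0 th1) _.
  rewrite ler_wpM2l ?mulr_ge0 ?powR_ge0//.
  by have [Xz zM] := sM u u0 uT; rewrite (le_trans (Xc _ Xz))// ler_wpM2l.
apply: le_trans (lerD e1 e2) _; rewrite mulrDr.
by apply: lerD; rewrite ler_wpM2r ?powR_ge0// ?lerDl ?lerDr !mulr_ge0.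
Qed.

Let chain_remainder (v : R) : R :=
  F v (y v) - time_antiderivative v - space_antiderivative v.

(* The power in the control absorbs the singularity of [A (y r)] at [r = 0]:
   it is an antiderivative of the bound [r `^ (alpha - 1)], up to a factor. *)
Let control (v : R) : R := v + v `^ alpha.

(** The three errors -- time increment, transported orbit, convolution -- are
    each [o(1)] times an increment of the control: the first by uniform
    continuity, the others because [alpha * gamma > 0], [alpha + eta > 1] and
    [eta + alpha * gamma > 1]. *)
Lemma chain_remainder_increment e : 0 < e -> exists2 d, 0 < d & forall u v,
  0 <= u -> u < v -> v <= T -> v - u < d ->
  `|(x v - x u) * diff_x F u (y u) (sigma (y u))
    - (chain_remainder v - chain_remainder u)| <= e * (control v - control u).
Proof.
move=> e0; have e2 : 0 < e / 2 by rewrite divr_gt0.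
have e8 : 0 < e / 8 by rewrite divr_gt0.
have [d1 d10 E1] := time_increment e2.
have [C1 C10 E2] := orbit_increment; have [C2 C20 E3] := convolution_increment.
have C120 : 0 <= C1 + C2 by rewrite addr_ge0.
have th1 : 0 < alpha + eta - 1 by rewrite subr_gt0.
have eag1 : 0 < eta + alpha * gamma - 1 by rewrite subr_gt0.
have [d2 d20 P2] := powR_small C10 ag0 e2.
have [d3 d30 P3] := powR_small C120 th1 e8.
have [d4 d40 P4] := powR_small C20 eag1 e8.
exists (Num.min (Num.min d1 d2) (Num.min d3 d4)).
  by rewrite !lt_min d10 d20 d30.
move=> u v u0 uv vT; rewrite !lt_min => /andP[/andP[h1 h2] /andP[h3 h4]].
have uT : u <= T by rewrite (le_trans (ltW uv)).
have vu : 0 < v - u by rewrite subr_gt0.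
have vu0 := ltW vu.
have [theta [th0 th01 FE]] := mean_value_space (y u) (y v) u0 uT.
have {}E1 := E1 u v u0 uv vT h1.
have {}E2 := E2 u v theta u0 uv vT th0 th01.
have {}E3 := E3 u v theta u0 uv vT th0 th01.
have {}P2 := P2 _ vu0 (ltW h2); have {}P3 := P3 _ vu0 (ltW h3).
have {}P4 := P4 _ vu0 (ltW h4).
have Fsplit : F u (y v) - F u (y u) =
    diff_x F u (y u + theta *: (y v - y u)) (S (v - u) (y u) - y u)
    + diff_x F u (y u + theta *: (y v - y u)) (increment S y u v).
  rewrite FE -diff_xD; congr (diff_x _ _ _ _).
  by rewrite /increment [RHS]addrC subrKA.
have uv_alpha : 0 <= v `^ alpha - u `^ alpha.
  by rewrite subr_ge0 powR_le_exp ?(ltW alpha0) ?(ltW uv).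
rewrite -(mulr_powRB1 vu0 (lt_trans ltr01 young)) in E2 E3.
rewrite -(mulr_powRB1 vu0 (lt_trans ltr01 young_chain)) in E3.
have -> : (x v - x u) * diff_x F u (y u) (sigma (y u))
    - (chain_remainder v - chain_remainder u) =
    - ((F v (y v) - F u (y v) - (time_antiderivative v - time_antiderivative u))
       + (diff_x F u (y u + theta *: (y v - y u)) (S (v - u) (y u) - y u)
          - (space_antiderivative v - space_antiderivative u))
       + (diff_x F u (y u + theta *: (y v - y u)) (increment S y u v)
          - (x v - x u) * diff_x F u (y u) (sigma (y u)))).
  have {Fsplit E1 E2 E3}-> : F u (y v) = F u (y u) +
    (diff_x F u (y u + theta *: (y v - y u)) (S (v - u) (y u) - y u)
    + diff_x F u (y u + theta *: (y v - y u)) (increment S y u v)).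
    by rewrite -Fsplit subrKC.
  rewrite /chain_remainder.
  move: (diff_x _ _ _ _) (diff_x _ _ _ _) (diff_x _ _ _ _) => l1 l2 l3.
  ring.
rewrite normrN (le_trans (ler_normD _ _))//.
apply: le_trans (lerD (ler_normD _ _) (lexx _)) _.
apply: le_trans (lerD (lerD E1 E2) E3) _.
have Q2 := ler_wpM2r uv_alpha P2.
have Q3 := ler_wpM2r vu0 P3.
have Q4 := ler_wpM2r vu0 P4.
have eh : 0 <= e * (v - u) by rewrite mulr_ge0// ltW.
have ea : 0 <= e * (v `^ alpha - u `^ alpha) by rewrite mulr_ge0// ltW.
by rewrite /control; lra.
Qed.

Lemma chain_rule_along_solution s t : 0 <= s -> s < t -> t <= T ->
  [/\ forall u, s < u -> u <= t -> D (y u),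
      lebesgue_measure.-integrable `]s, t] (fun u => (Ft u (y u))%:E),
      lebesgue_measure.-integrable `]s, t]
        (fun u => (diff_x F u (y u) (A (y u)))%:E) &
      exists2 I : R^o,
        is_stieltjes_integral (fun u => diff_x F u (y u) (sigma (y u)) : R^o)
          x s t I &
        F t (y t) - F s (y s) =
          \int[lebesgue_measure]_(u in `]s, t]) Ft u (y u)
          + \int[lebesgue_measure]_(u in `]s, t]) diff_x F u (y u) (A (y u))
          + I].
Proof.
move=> s0 st tT.
have [C1 _ bnd1] := time_integrand_bounded.
have [C2 _ bnd2] := space_integrand_bounded.
have [int1 eq1] := antiderivativeB T0 alpha0 bnd1 time_integrand_continuous
  s0 (ltW st) tT.
have [int2 eq2] := antiderivativeB T0 alpha0 bnd2 space_integrand_continuous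
  s0 (ltW st) tT.
split => [u su ut| | |] //.
  by apply: (y_generatorE s0 su (le_trans ut tT)).1.
exists (chain_remainder t - chain_remainder s); last first.
  rewrite [X in X + _ + _]eq1 [X in _ + X + _]eq2 /chain_remainder.
  by rewrite /time_antiderivative /space_antiderivative; ring.
apply: (@stieltjes_integral_telescope _ _ _ x chain_remainder control).
- exact: ltW.
- by rewrite /control lerD ?powR_le_exp ?(ltW alpha0) ?(ltW st).
- move=> e /chain_remainder_increment[d d0 dP]; exists d => // u v su uv vt.
  by apply: dP => //; [exact: le_trans su|exact: le_trans tT].
Qed.

End chain_rule.

Theorem theorem5p1 (R : realType) (X : completeNormedModType R)
    (D : set X) (A : X -> X) (S : R -> X -> X) (Xs : R -> banach_subspace X)
    (T eta alpha gamma : R) (x : R -> R) (sigma : X -> X) (psi : X)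
    (F Ft : R -> X -> R) (y : R -> X) :
  0 < T ->
  structural_assumptions D A S Xs ->
  1 / 2 < eta -> eta < 1 ->
  holder_on 0 T eta x ->
  0 < alpha -> alpha < 1 -> 1 < alpha + eta ->
  sigma_assumptions Xs alpha sigma ->
  Xs alpha psi ->
  C1_with T F Ft ->
  diff_x_holder_t T alpha F ->
  0 < gamma -> gamma < 1 -> 1 < eta + alpha * gamma ->
  diff_x_holder_x T gamma F ->
  mild_solution S Xs sigma x psi T alpha y ->
  hat_C S (Xs alpha) 0 T alpha y ->
  forall s t, 0 <= s -> s < t -> t <= T ->
  [/\ forall u, s < u -> u <= t -> D (y u),
      lebesgue_measure.-integrable `]s, t] (fun u => (Ft u (y u))%:E),
      lebesgue_measure.-integrable `]s, t]
        (fun u => (diff_x F u (y u) (A (y u)))%:E) &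
      exists2 I : R^o,
        is_stieltjes_integral (fun u => diff_x F u (y u) (sigma (y u)) : R^o)
          x s t I &
        F t (y t) - F s (y s) =
          \int[lebesgue_measure]_(u in `]s, t]) Ft u (y u)
          + \int[lebesgue_measure]_(u in `]s, t]) diff_x F u (y u) (A (y u))
          + I].
Proof.
move=> T0 structural eta12 eta1 x_holder alpha0 alpha1 young sigmaP _ F_C1 Ft_h.
move=> gamma0 gamma1 young_chain Fx_h mild y_regular s t.
have eta0 : 0 < eta by apply: lt_trans eta12; rewrite divr_gt0.
exact: (chain_rule_along_solution T0 structural eta0 x_holder alpha0 alpha1
  young sigmaP F_C1 Ft_h gamma0 gamma1 young_chain Fx_h mild y_regular).
Qed.
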